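(* Let $(X,d,\mu)$ be a space of homogeneous type with $\mu(X)=\infty$ and $\mu(\{x_0\})=0$ for every $x_0\in X$. Suppose $1<p<\infty$, $\lambda_1,\lambda_2\in A_p$, $\nu:=\lambda_1^{1/p}\lambda_2^{-1/p}$ and $m\in\mathbb N$ (with $m\ge1$). Suppose $b\in L^1_{\rm loc}(X)$ and that $T$ is a Calderón–Zygmund operator on $(X,d,\mu)$ (with modulus $\omega$ satisfying $\omega(t)\to0$ as $t\to0$) whose kernel $K$ satisfies the following non-degeneracy condition: there exist positive constants $c_0$ and $\overline C$ such that for every $x\in X$ and $r>0$ there exists $y\in B(x,\overline C r)\setminus B(x,r)$ with $$|K(x,y)|\ge \frac{1}{c_0\,\mu(B(x,r))}.$$ Also suppose that $T_b^m$ is bounded from $L^p_{\lambda_1}(X)$ to $L^p_{\lambda_2}(X)$. Then $b\in \mathrm{BMO}_{\nu^{1/m}}(X)$, and there exists a positive constant $C_2$, independent of $b$, such that $$\|b\|^m_{\mathrm{BMO}_{\nu^{1/m}}(X)}\le C_2\,\|T_b^m: L^p_{\lambda_1}(X)\to L^p_{\lambda_2}(X)\|.$$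
   Context: A space of homogeneous type $(X,d,\mu)$: $d$ is a quasi-metric on $X$ (symmetric, $d(x,y)=0$ iff $x=y$, and $d(x,y)\le A_0[d(x,z)+d(z,y)]$ for some constant $A_0\ge 1$), and $\mu$ is a nonzero measure which is doubling: $\mu(B(x,2r))\le C_\mu\,\mu(B(x,r))<\infty$ for all $x\in X$, $r>0$, where $B(x,r)=\{y\in X: d(x,y)<r\}$. Put $V(x,y)=\mu(B(x,d(x,y)))$. Calderón–Zygmund operator: $T$ is bounded on $L^2(X)$ and has a kernel $K(x,y)$ such that $Tf(x)=\int_X K(x,y)f(y)\,d\mu(y)$ for $x\notin \mathrm{supp} f$, and, for all $x\neq y$, $|K(x,y)|\le C/V(x,y)$, and, for $d(x,x')\le (2A_0)^{-1}d(x,y)$, $|K(x,y)-K(x',y)|+|K(y,x)-K(y,x')|\le \frac{C}{V(x,y)}\,\omega\big(\frac{d(x,x')}{d(x,y)}\big)$, where $\omega:[0,1]\to[0,\infty)$ is continuous, increasing, subadditive and $\omega(0)=0$. Commutators: $T_b^1f=[b,T]f:=b\,T(f)-T(bf)$ and inductively $T_b^mf:=[b,T_b^{m-1}]f$. Weights: for $1<p<\infty$, a nonnegative locally integrable $w$ is in $A_p$ if $[w]_{A_p}:=\sup_B\big(\frac1{\mu(B)}\int_B w\,d\mu\big)\big(\frac1{\mu(B)}\int_B w^{-1/(p-1)}d\mu\big)^{p-1}<\infty$, the supremum over all balls $B\subset X$; $A_\infty=\bigcup_{1\le p<\infty}A_p$. $L^p_w(X)$ has norm $(\int_X|f|^pw\,d\mu)^{1/p}$,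 and $w(B)=\int_B w\,d\mu$. Weighted BMO: for $w\in A_\infty$, $b\in L^1_{\rm loc}(X)$ is in $\mathrm{BMO}_w(X)$ if $\|b\|_{\mathrm{BMO}_w(X)}:=\sup_B\frac1{w(B)}\int_B|b-b_B|\,d\mu<\infty$, where $b_B=\frac1{\mu(B)}\int_B b\,d\mu$ and the supremum is over all balls $B\subset X$. *)

(* Defs.v *)
From HB Require Import structures.
From mathcomp Require Import all_boot all_order all_algebra.
From mathcomp Require Import complex.
From mathcomp Require Import all_classical all_reals all_analysis.

Set Implicit Arguments.
Unset Strict Implicit.
Unset Printing Implicit Defensive.

Import Order.TTheory GRing.Theory Num.Theory.
Import numFieldNormedType.Exports.

Local Open Scope classical_set_scope.
Local Open Scope ring_scope.
Local Open Scope complex_scope.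

Section homogeneous_type.
Context {R : realType} {X : Type}.

Definition quasi_metric (rho : X -> X -> R) (A0 : R) : Prop :=
  [/\ 1 <= A0,
      (forall x y, 0 <= rho x y),
      (forall x y, rho x y = 0 <-> x = y),
      (forall x y, rho x y = rho y x) &
      (forall x y z, rho x y <= A0 * (rho x z + rho z y))].

Definition qball (rho : X -> X -> R) (x : X) (r : R) : set X := [set y | rho x y < r].

End homogeneous_type.

(* The sigma-algebra is only required to contain the balls.  As X is separable
   and metrizable, it then contains all Borel sets. *)
Definition homogeneous_type {R : realType} {d : measure_display}
    {X : measurableType d} (rho : X -> X -> R) (A0 : R)
    (mu : {measure set X -> \bar R}) : Prop :=
  [/\ quasi_metric rho A0,
      (forall x r, measurable (qball rho x r)),
      mu [set: X] != 0%E &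
      exists Cmu : R, forall x r, 0 < r ->
        (mu (qball rho x (2 * r)) <= Cmu%:E * mu (qball rho x r))%E /\
        (mu (qball rho x r) < +oo)%E].

Section defs.
Context {R : realType} {d : measure_display} {X : measurableType d}.
Variables (rho : X -> X -> R) (A0 : R) (mu : {measure set X -> \bar R}).
Implicit Types (w : X -> R) (f b : X -> R[i]) (S T : (X -> R[i]) -> (X -> R[i])).

(* Balls have finite measure in a space of homogeneous type, so that taking
   [fine] loses nothing. *)
Definition vball (x : X) (r : R) : R := fine (mu (qball rho x r)).

Definition V (x y : X) : R := vball x (rho x y).

Definition cmeasurable f : Prop :=
  measurable_fun setT (fun x => complex.Re (f x)) /\
  measurable_fun setT (fun x => complex.Im (f x)).

Definition cintegrable (D : set X) f : Prop :=
  mu.-integrable D (fun x => (complex.Re (f x))%:E) /\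
  mu.-integrable D (fun x => (complex.Im (f x))%:E).

Definition cintegral (D : set X) f : R[i] :=
  (Rintegral mu D (fun x => complex.Re (f x))) +i*
  (Rintegral mu D (fun x => complex.Im (f x))).

Definition wnorm (p : R) w f : \bar R :=
  ((\int[mu]_x ((ComplexField.Normc.normc (f x)) `^ p * w x)%:E) `^ p^-1)%E.

Definition in_Lpw (p : R) w f : Prop :=
  cmeasurable f /\ (wnorm p w f < +oo)%E.

Definition L2norm f : \bar R := wnorm 2 (cst 1) f.

Definition in_L2 f : Prop := in_Lpw 2 (cst 1) f.

Definition L1loc f : Prop :=
  cmeasurable f /\ forall x r, 0 < r -> cintegrable (qball rho x r) f.

(* T acts on functions rather than on classes modulo equality almost everywhere,
   and only its restriction to L^2 is meaningful.  Linearity and boundedness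
   imply that T respects equality almost everywhere. *)
Definition L2_bounded_linear T : Prop :=
  (forall (a : R[i]) f g, in_L2 f -> in_L2 g ->
     {ae mu, forall x, T (fun y => a * f y + g y) x = a * T f x + T g x}) /\
  (exists M : R, forall f, in_L2 f ->
     cmeasurable (T f) /\ (L2norm (T f) <= M%:E * L2norm f)%E).

(* The closure of {f != 0} in the topology of the quasi-metric. *)
Definition supp f : set X :=
  [set x | forall r, 0 < r -> qball rho x r `&` [set y | f y != 0] !=set0].

(* The class T f is defined up to null sets, so the formula is required almost
   everywhere off the support. *)
Definition has_kernel T (K : X -> X -> R[i]) : Prop :=
  forall f, in_L2 f ->
    {ae mu, forall x, ~ supp f x ->
       cintegrable setT (fun y => K x y * f y) /\
       T f x = cintegral setT (fun y => K x y * f y)}.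

Definition modulus_of_continuity (omega : R -> R) : Prop :=
  [/\ {within `[0, 1], continuous omega},
      (forall t, 0 <= t <= 1 -> 0 <= omega t),
      (forall s t, 0 <= s -> s <= t -> t <= 1 -> omega s <= omega t),
      (forall s t, 0 <= s -> 0 <= t -> s + t <= 1 ->
         omega (s + t) <= omega s + omega t) &
      omega 0 = 0].

Definition calderon_zygmund T (K : X -> X -> R[i]) (omega : R -> R) : Prop :=
  [/\ L2_bounded_linear T,
      has_kernel T K,
      modulus_of_continuity omega &
      exists2 C : R, 0 < C &
        (forall x y, x <> y ->
           ComplexField.Normc.normc (K x y) <= C / V x y) /\
        (forall x x' y, x <> y -> rho x x' <= (2 * A0)^-1 * rho x y ->
           ComplexField.Normc.normc (K x y - K x' y)
           + ComplexField.Normc.normc (K y x - K y x')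
           <= C / V x y * omega (rho x x' / rho x y))].

Definition nondegenerate_kernel (K : X -> X -> R[i]) : Prop :=
  exists c0 Cbar : R, [/\ 0 < c0, 0 < Cbar &
    forall x r, 0 < r ->
      exists y, [/\ (qball rho x (Cbar * r) `\` qball rho x r) y &
                    (c0 * vball x r)^-1 <= ComplexField.Normc.normc (K x y)]].

Definition commutator b S : (X -> R[i]) -> (X -> R[i]) :=
  fun f x => b x * S f x - S (fun y => b y * f y) x.

Definition iter_commutator (m : nat) b T : (X -> R[i]) -> (X -> R[i]) :=
  iter m (commutator b) T.

(* T is defined on L^2, and unfolding the iterated commutator applies T exactly
   to the functions b^k f with k <= m: these must lie in L^2. *)
Definition commutator_dom (m : nat) b f : Prop :=
  forall k, (k <= m)%N -> in_L2 (fun x => b x ^+ k * f x).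

(* Equal to +oo when no finite bound exists. *)
Definition commutator_norm (m : nat) b T (p : R) (w1 w2 : X -> R) : \bar R :=
  ereal_inf [set N%:E | N in [set N : R | 0 <= N /\
    forall f, commutator_dom m b f -> in_Lpw p w1 f ->
      (wnorm p w2 (iter_commutator m b T f) <= N%:E * wnorm p w1 f)%E]].

Definition avg (B : set X) w : \bar R :=
  ((\int[mu]_(x in B) (w x)%:E) / mu B)%E.

(* Negative powers must be +oo where w vanishes, whereas [0 `^ a = 0] for a < 0
   in the library; this is harmless as w vanishes on a null set only. *)
Definition weight w : Prop :=
  [/\ measurable_fun setT w,
      (forall x, 0 <= w x),
      {ae mu, forall x, 0 < w x} &
      forall x r, 0 < r -> (\int[mu]_(y in qball rho x r) (w y)%:E < +oo)%E].

Definition Ap_const (p : R) w : \bar R :=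
  ereal_sup [set z | exists x r, 0 < r /\
    z = (avg (qball rho x r) w *
         avg (qball rho x r) (fun y => w y `^ (- (p - 1)^-1))%R `^ (p - 1)%R)%E].

Definition Ap (p : R) w : Prop := weight w /\ (Ap_const p w < +oo)%E.

Definition A1 w : Prop := weight w /\
  exists C : R, forall x r, 0 < r ->
    {ae mu, forall y, qball rho x r y ->
       (avg (qball rho x r) w <= (C * w y)%:E)%E}.

Definition Ainfty w : Prop := A1 w \/ exists2 p : R, 1 < p & Ap p w.

Definition cavg (B : set X) f : R[i] := ((fine (mu B))^-1)%:C * cintegral B f.

Definition bmo_norm w b : \bar R :=
  ereal_sup [set z | exists x r, 0 < r /\
    z = ((\int[mu]_(y in qball rho x r)
            (ComplexField.Normc.normc (b y - cavg (qball rho x r) b))%:E)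
         / \int[mu]_(y in qball rho x r) (w y)%:E)%E].

Definition in_BMO w b : Prop :=
  [/\ Ainfty w, L1loc b & (bmo_norm w b < +oo)%E].

End defs.

(* Main.v *)
Require Import Defs.
From mathcomp Require Import all_boot all_order all_algebra.
From mathcomp Require Import complex ring lra.
From mathcomp Require Import all_classical all_reals all_analysis measurable_realfun.
Set Implicit Arguments.
Unset Strict Implicit.
Unset Printing Implicit Defensive.
Import Order.TTheory GRing.Theory Num.Theory.
Import numFieldNormedType.Exports.
Local Open Scope classical_set_scope.
Local Open Scope ring_scope.
Local Open Scope complex_scope.
Local Notation normc := ComplexField.Normc.normc.
Local Notation Re := complex.Re.
Local Notation Im := complex.Im.

(** Fix a ball [B].  Non-degeneracy and regularity of the kernel provide a ball
    [B2] of the same radius, at a comparable distance from [B], such that on the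
    product of [B] and [B2] the kernel [K] is within [eps * |k0|] of a constant
    [k0], which is as large as the size condition permits ([frozen_kernel]).
    For [f] supported in [B2] and [x] in [B],
      [T_b^m f x = \int K x y * (b x - b y)^m * f y dy],
    and freezing the kernel leaves [k0 * \int (b x - b y)^m * f y dy].

    As a function of [b y], [(b x - b y)^m] is a polynomial of degree [m], whatever
    [x] is.  On a space of dimension [m.+1] the [L^1] norm is, up to a constant,
    the sum of [m.+1] functionals, here integrals against functions [f_j] bounded
    by an indicator ([norming_functionals], [norming_test_functions]).  As [x] does
    not enter into the choice of the [f_j], finitely many test functions detect
    [\int |b x - b y|^m dy] for all [x] at once.  This replaces the decomposition
    by a median, which needs a real-valued [b], and it makes the error of freezing
    the kernel absorbable at every single point [x] ([absorb_frozen_kernel]).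
    With [c] the mean of [b] over (most of) [B2], it follows that
      [|b x - c|^m <= C / (|k0| * mu B2) * \sum_j |T_b^m f_j x|]
    for almost every [x] in [B].

    Integrating over [B], Hölder's inequality and the boundedness of [T_b^m] bound
    the right-hand side by [N * L `^ (1/p) * L' `^ (1 - 1/p)], where [L] and [L'] are
    the integrals of [lambda1] and of the dual weight of [lambda2] over a larger
    ball.  The two [A_p] conditions bound this product by the square of the volume
    over [\int nu^-1] ([bloom_ball]), and Hölder's inequality bounds the
    latter quotient by the [m]-th power of [\int_B nu^(1/m)], normalised by the
    volume ([vball_le_bloom_root]).  Jensen's inequality on the left-hand side
    concludes.  The same inequalities show that [nu^(1/m)] is an [A_2] weight. *)

(** * Complex numbers and integrals of complex functions *)

Section complex_basics.
Context {R : realType}.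
Implicit Types z w : R[i].

Lemma normcE z : normc z = Num.sqrt (Re z ^+ 2 + Im z ^+ 2).
Proof. by case: z. Qed.

Lemma normc_ge0 z : 0 <= normc z.
Proof. by rewrite normcE sqrtr_ge0. Qed.

Lemma complex_ReD z w : Re (z + w) = Re z + Re w.
Proof. by case: z; case: w. Qed.

Lemma complex_ImD z w : Im (z + w) = Im z + Im w.
Proof. by case: z; case: w. Qed.

Lemma complex_ReM z w : Re (z * w) = Re z * Re w - Im z * Im w.
Proof. by case: z; case: w. Qed.

Lemma complex_ImM z w : Im (z * w) = Re z * Im w + Im z * Re w.
Proof. by case: z => a b; case: w => c d. Qed.

Lemma eq_ReIm z w : Re z = Re w -> Im z = Im w -> z = w.
Proof. by case: z => a b; case: w => c d /= -> ->. Qed.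

Lemma normcM z w : normc (z * w) = normc z * normc w.
Proof. exact: ComplexField.Normc.normcM. Qed.

Lemma ler_normcD z w : normc (z + w) <= normc z + normc w.
Proof. exact: le_normcD. Qed.

Lemma normcN z : normc (- z) = normc z.
Proof. exact: complex.normcN. Qed.

Lemma ler_normcB z w : normc (z - w) <= normc z + normc w.
Proof. by rewrite -(normcN w); exact: ler_normcD. Qed.

Lemma normcX z n : normc (z ^+ n) = normc z ^+ n.
Proof.
elim: n => [|n IH]; first by rewrite !expr0 ComplexField.Normc.normc1.
by rewrite !exprS normcM IH.
Qed.

Lemma normc_real (a : R) : normc a%:C = `|a|.
Proof. by rewrite normcE /= expr0n addr0 sqrtr_sqr. Qed.

Lemma ler_Re_normc z : `|Re z| <= normc z.
Proof. by rewrite normcE -sqrtr_sqr ler_wsqrtr// lerDl sqr_ge0. Qed.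

Lemma ler_Im_normc z : `|Im z| <= normc z.
Proof. by rewrite normcE -sqrtr_sqr ler_wsqrtr// lerDr sqr_ge0. Qed.

Lemma ler_normc_ReIm z : normc z <= `|Re z| + `|Im z|.
Proof.
rewrite normcE -[leRHS]ger0_norm ?addr_ge0// -sqrtr_sqr ler_wsqrtr//.
by rewrite sqrrD !real_normK ?num_real// lerD2r lerDl mulrn_wge0// mulr_ge0.
Qed.

(** The conjugate phase of [z].  The value [0] at [z = 0] makes [unphaseM]
    unconditional. *)
Definition unphase z : R[i] := ((normc z)^-1)%:C * (Re z +i* - Im z)%C.

Lemma unphaseM z : z * unphase z = (normc z)%:C.
Proof.
have [z0|z0] := eqVneq (normc z) 0.
  by rewrite z0 (ComplexField.Normc.eq0_normc z0) mul0r.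
have E : normc z ^+ 2 = Re z ^+ 2 + Im z ^+ 2.
  by rewrite normcE sqr_sqrtr// addr_ge0 ?sqr_ge0.
apply: eq_ReIm; rewrite /unphase ?complex_ReM ?complex_ImM /=.
  transitivity ((normc z)^-1 * (Re z ^+ 2 + Im z ^+ 2)); first by ring.
  by rewrite -E expr2 mulKf.
by ring.
Qed.

Lemma unphase_le1 z : normc (unphase z) <= 1.
Proof.
rewrite /unphase normcM normc_real.
have -> : normc (Re z +i* - Im z)%C = normc z by rewrite !normcE /= sqrrN.
have [->|z0] := eqVneq (normc z) 0; first by rewrite mulr0.
by rewrite normrV ?unitfE// ger0_norm ?normc_ge0// mulVf.
Qed.

Lemma normc0 : normc (0 : R[i]) = 0.
Proof. exact: ComplexField.Normc.normc0. Qed.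

End complex_basics.

Section complex_integral.
Context {R : realType} {d : measure_display} {X : measurableType d}.
Variable mu : {measure set X -> \bar R}.
Implicit Types (f g : X -> R[i]) (D : set X).

Lemma cmeasurable_cst (a : R[i]) : cmeasurable (fun _ : X => a).
Proof. by split; exact: measurable_cst. Qed.

Lemma cmeasurableD f g : cmeasurable f -> cmeasurable g ->
  cmeasurable (fun x => f x + g x).
Proof.
move=> [f1 f2] [g1 g2]; split.
- by under eq_fun do rewrite complex_ReD; exact: measurable_funD.
- by under eq_fun do rewrite complex_ImD; exact: measurable_funD.
Qed.

Lemma cmeasurableM f g : cmeasurable f -> cmeasurable g ->
  cmeasurable (fun x => f x * g x).
Proof.
move=> [f1 f2] [g1 g2]; split.
- by under eq_fun do rewrite complex_ReM; apply: measurable_funB; exact: measurable_funM.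
- by under eq_fun do rewrite complex_ImM; apply: measurable_funD; exact: measurable_funM.
Qed.

Lemma cmeasurableB f g : cmeasurable f -> cmeasurable g ->
  cmeasurable (fun x => f x - g x).
Proof.
move=> mf mg.
have := cmeasurableD mf (cmeasurableM (cmeasurable_cst (-1)) mg).
by under eq_fun do rewrite mulN1r.
Qed.

Lemma cmeasurableX f n : cmeasurable f -> cmeasurable (fun x => f x ^+ n).
Proof.
move=> mf; elim: n => [|n IH].
  by under eq_fun do rewrite expr0; exact: cmeasurable_cst.
by under eq_fun do rewrite exprS; exact: cmeasurableM.
Qed.

Lemma measurable_normc f : cmeasurable f ->
  measurable_fun setT (fun x => normc (f x)).
Proof.
move=> [f1 f2]; under eq_fun do rewrite normcE -powR12_sqrt ?addr_ge0 ?sqr_ge0//.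
apply: (measurableT_comp (measurable_powR _)) => //.
by apply: measurable_funD; exact: measurable_funX.
Qed.

Lemma cmeasurable_real (h : X -> R) : measurable_fun setT h ->
  cmeasurable (fun x => (h x)%:C).
Proof. by move=> mh; split => //=; exact: measurable_cst. Qed.

Lemma cmeasurable_unphase f : cmeasurable f ->
  cmeasurable (fun x => unphase (f x)).
Proof.
move=> mf; apply: cmeasurableM.
  apply: cmeasurable_real.
  have -> : (fun x => (normc (f x))^-1) = (fun x => normc (f x) `^ (-1)).
    by apply/funext => x; rewrite powR_inv1// normc_ge0.
  by apply: (measurableT_comp (measurable_powR _)) => //; exact: measurable_normc.
by split => /=; [case: mf|apply: measurable_funN; case: mf].
Qed.

Lemma cintegrable_le D f (h : X -> R) : measurable D -> cmeasurable f ->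
  mu.-integrable D (EFin \o h) -> (forall x, D x -> normc (f x) <= h x) ->
  cintegrable mu D f.
Proof.
move=> mD [f1 f2] ih fh; split; apply: (le_integrable mD _ _ ih).
- by apply/measurable_EFinP; exact: measurable_funTS.
- move=> x Dx /=; rewrite lee_fin (le_trans (ler_Re_normc _))//.
  by rewrite (le_trans (fh _ Dx)) ?ler_norm.
- by apply/measurable_EFinP; exact: measurable_funTS.
- move=> x Dx /=; rewrite lee_fin (le_trans (ler_Im_normc _))//.
  by rewrite (le_trans (fh _ Dx)) ?ler_norm.
Qed.

Lemma cintegrableD D f g : measurable D ->
  cintegrable mu D f -> cintegrable mu D g ->
  cintegrable mu D (fun x => f x + g x).
Proof.
move=> mD [f1 f2] [g1 g2]; split.
- by under eq_fun do rewrite complex_ReD EFinD; exact: integrableD.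
- by under eq_fun do rewrite complex_ImD EFinD; exact: integrableD.
Qed.

Lemma cintegrableZ D (a : R[i]) f : measurable D -> cintegrable mu D f ->
  cintegrable mu D (fun x => a * f x).
Proof.
move=> mD [f1 f2]; split.
- under eq_fun do rewrite complex_ReM EFinB !EFinM.
  by apply: integrableB => //; exact: integrableZl.
- under eq_fun do rewrite complex_ImM EFinD !EFinM.
  by apply: integrableD => //; exact: integrableZl.
Qed.

Lemma cintegralD D f g : measurable D ->
  cintegrable mu D f -> cintegrable mu D g ->
  cintegral mu D (fun x => f x + g x) = cintegral mu D f + cintegral mu D g.
Proof.
move=> mD [f1 f2] [g1 g2]; apply: eq_ReIm; rewrite ?complex_ReD ?complex_ImD /=.
- by under eq_Rintegral do rewrite complex_ReD; rewrite RintegralD.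
- by under eq_Rintegral do rewrite complex_ImD; rewrite RintegralD.
Qed.

Lemma integrable_scale D (a : R) (h : X -> R) : measurable D ->
  mu.-integrable D (EFin \o h) -> mu.-integrable D (EFin \o (fun x => a * h x)).
Proof.
by move=> mD ih; rewrite /comp; under eq_fun do rewrite EFinM; exact: integrableZl.
Qed.

Lemma cintegralZ D (a : R[i]) f : measurable D -> cintegrable mu D f ->
  cintegral mu D (fun x => a * f x) = a * cintegral mu D f.
Proof.
move=> mD [f1 f2]; apply: eq_ReIm; rewrite ?complex_ReM ?complex_ImM /=.
- under eq_Rintegral do rewrite complex_ReM.
  by rewrite RintegralB ?RintegralZl//; exact: integrable_scale.
- under eq_Rintegral do rewrite complex_ImM.
  by rewrite RintegralD ?RintegralZl//; exact: integrable_scale.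
Qed.

Lemma integrable_normc D f : measurable D -> cintegrable mu D f ->
  mu.-integrable D (fun x => (normc (f x))%:E).
Proof.
move=> mD [f1 f2].
have i12 : mu.-integrable D (fun x => (`|Re (f x)| + `|Im (f x)|)%:E).
  under eq_fun do rewrite EFinD.
  by apply: integrableD => //; exact: integrable_norm.
apply: (le_integrable mD _ _ i12).
- have /measurable_EFinP m1 := measurable_int _ f1.
  have /measurable_EFinP m2 := measurable_int _ f2.
  apply/measurable_EFinP.
  under eq_fun do rewrite normcE -powR12_sqrt ?addr_ge0 ?sqr_ge0//.
  apply: (measurableT_comp (measurable_powR _)) => //.
  by apply: measurable_funD; exact: measurable_funX.
- move=> x Dx /=; rewrite lee_fin ger0_norm ?normc_ge0//.
  by rewrite ger0_norm ?addr_ge0// ler_normc_ReIm.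
Qed.

(** Rotating the integral onto the positive axis reduces the estimate to that
    of the real part of the rotated integrand. *)
Lemma normc_cintegral_le D f (h : X -> R) : measurable D ->
  cintegrable mu D f -> mu.-integrable D (EFin \o h) ->
  (forall x, D x -> normc (f x) <= h x) ->
  normc (cintegral mu D f) <= \int[mu]_(x in D) h x.
Proof.
move=> mD fi hi fh; set I := cintegral mu D f.
have -> : normc I = Re (cintegral mu D (fun x => unphase I * f x)).
  by rewrite cintegralZ// mulrC unphaseM.
rewrite /cintegral /=; apply: le_Rintegral => //.
  by case: (cintegrableZ (unphase I) mD fi).
move=> x Dx; rewrite (le_trans _ (fh x Dx))// (le_trans (ler_norm _))//.
rewrite (le_trans (ler_Re_normc _))// normcM -[leRHS]mul1r ler_wpM2r ?normc_ge0//.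
exact: unphase_le1.
Qed.

Lemma eq_cintegral D f g : {in D, f =1 g} -> cintegral mu D f = cintegral mu D g.
Proof.
by move=> fg; apply: eq_ReIm => /=; apply: eq_Rintegral => x xD; rewrite fg.
Qed.

End complex_integral.

(** * Norming functionals for polynomials *)

Section norming_functionals.
Context {R : realType} {I : Type}.
Implicit Types P Q : {poly R[i]}.
Variables (n : {poly R[i]} -> R) (phi : I -> {poly R[i]} -> R[i]).

Hypothesis n_ge0 : forall P, 0 <= n P.
Hypothesis nD : forall P Q, n (P + Q) <= n P + n Q.
Hypothesis nZ : forall a P, n (a *: P) = normc a * n P.
Hypothesis phi_linear : forall f a P Q,
  phi f (a *: P + Q) = a * phi f P + phi f Q.
Hypothesis phi_le : forall f P, normc (phi f P) <= n P.
Hypothesis phi_attains : forall P, exists f, phi f P = (n P)%:C.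
Hypothesis phi_zero : exists f, forall P, phi f P = 0.

Let phi0 f : phi f 0 = 0.
Proof.
have := phi_linear f (-1) 0 0; rewrite scaler0 add0r mulN1r => ->.
by rewrite addNr.
Qed.

Let phiD f P Q : phi f (P + Q) = phi f P + phi f Q.
Proof. by have := phi_linear f 1 P Q; rewrite scale1r mul1r. Qed.

Let phiZ f a P : phi f (a *: P) = a * phi f P.
Proof. by have := phi_linear f a P 0; rewrite !addr0 phi0 addr0. Qed.

(** Induction on [k].  Let [psi] be ['X^k] corrected so that the functionals
    found so far vanish on it, and let the next functional attain the norm of
    [psi].  On [a *: psi + q] the earlier functionals see [q] only, hence control
    [n q]; the new one then controls [normc a * n psi].  The second conclusion is
    what makes the correction of ['X^k] possible. *)
Lemma norming_functionals k : exists fs : nat -> I,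
  (forall Q, (size Q <= k)%N ->
     n Q <= 3 ^+ k * \sum_(j < k) normc (phi (fs j) Q)) /\
  (forall Q, exists2 q : {poly R[i]}, (size q <= k)%N &
     forall j, (j < k)%N -> phi (fs j) (Q - q) = 0).
Proof.
elim: k => [|k [fs [fsn fsq]]].
  have [f _] := phi_zero; exists (fun=> f); split => [Q|Q].
    rewrite leqn0 size_poly_eq0 => /eqP ->.
    by rewrite big_ord0 mulr0 -(scale0r 0) nZ normc0 mul0r.
  by exists 0; rewrite ?size_poly0.
have [q0 sq0 phq0] := fsq 'X^k.
set psi := 'X^k - q0.
have spsi : (size psi <= k.+1)%N.
  by rewrite (leq_trans (size_polyD _ _))// geq_max size_polyN size_polyXn leqnn leqW.
(* When [n psi = 0] the zero functional attains the norm of [psi] and, unlike an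
   arbitrary one, it does not spoil the second conclusion. *)
have [f [fpsi f0]] : exists f, phi f psi = (n psi)%:C /\
    (n psi = 0 -> forall P, phi f P = 0).
  have [e|e] := eqVneq (n psi) 0.
    by have [f hf] := phi_zero; exists f; rewrite hf e.
  have [f hf] := phi_attains psi; exists f; split => // e'.
  by rewrite e' eqxx in e.
pose fs' j := if j == k then f else fs j.
have fs'k : fs' k = f by rewrite /fs' eqxx.
have fs'j j : (j < k)%N -> fs' j = fs j.
  by move=> jk; rewrite /fs' ltn_eqF.
exists fs'; split => [Q sQ|Q].
  rewrite big_ord_recr /= fs'k.
  under eq_bigr => i _ do rewrite fs'j//.
  set A := \sum_(i < k) _.
  pose a := Q`_k; pose q := Q - a *: psi.
  have sq : (size q <= k)%N.
    apply/leq_sizeP => j kj; rewrite /q /psi !coefE.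
    have [->|jk] := eqVneq j k.
      by rewrite (nth_default 0 sq0) subr0 mulr1 subrr.
    have kj' : (k < j)%N by rewrite ltn_neqAle eq_sym jk.
    rewrite (nth_default 0 (leq_trans sQ kj')) (nth_default 0 (leq_trans sq0 kj)).
    by rewrite subr0 mulr0 subr0.
  have Qe : Q = a *: psi + q by rewrite /q addrC subrK.
  clearbody q.
  have Aq : \sum_(j < k) normc (phi (fs j) q) = A.
    by apply: eq_bigr => j _; rewrite Qe phiD phiZ /psi phq0// mulr0 add0r.
  have nq : n q <= 3 ^+ k * A by rewrite -Aq; exact: fsn.
  have na : normc a * n psi <= normc (phi f Q) + n q.
    have -> : normc a * n psi = normc (phi f Q - phi f q).
      rewrite Qe phiD phiZ addrK fpsi normcM normc_real.
      by rewrite (ger0_norm (n_ge0 psi)).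
    by rewrite (le_trans (ler_normcB _ _))// lerD2l phi_le.
  have nQ : n Q <= normc a * n psi + n q by rewrite {1}Qe (le_trans (nD _ _))// nZ.
  have A0 : 0 <= A by apply: sumr_ge0 => j _; exact: normc_ge0.
  have t1 : 1 <= 3 ^+ k :> R by rewrite exprn_ege1// ler1n.
  have f1 : normc (phi f Q) <= 3 ^+ k * normc (phi f Q).
    by rewrite -[leLHS]mul1r ler_wpM2r// normc_ge0.
  have := normc_ge0 (phi f Q); rewrite exprS.
  move: (3 ^+ k) (normc (phi f Q)) nq na nQ A0 t1 f1 => t u.
  move: (n Q) (n q) (normc a * n psi) => x y z nq na nQ A0 t1 f1 u0.
  have tA : 0 <= t * A by rewrite mulr_ge0// (le_trans _ t1).
  rewrite -mulrA mulrDr; lra.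
have [q sq phq] := fsq Q.
pose c := phi f (Q - q) / (n psi)%:C.
exists (q + c *: psi).
  rewrite (leq_trans (size_polyD _ _))// geq_max (leq_trans sq)//=.
  by rewrite (leq_trans (size_scale_leq _ _)).
have e : Q - (q + c *: psi) = (- c) *: psi + (Q - q).
  by rewrite opprD addrA addrC scaleNr.
move=> j; rewrite ltnS leq_eqVlt => /predU1P[->|jk].
  rewrite fs'k e phiD phiZ fpsi.
  have [e0|e0] := eqVneq (n psi) 0; first by rewrite (f0 e0) e0 mulr0 addr0.
  rewrite /c mulNr mulfVK ?addNr//.
  by apply: contra e0 => /eqP [->].
by rewrite fs'j// e phiD phiZ (phq j jk) /psi phq0// mulr0 addr0.
Qed.

End norming_functionals.

(** * Test functions *)

Section test_functions.
Context {R : realType} {d : measure_display} {X : measurableType d}.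
Variable mu : {measure set X -> \bar R}.
Implicit Types (f g b : X -> R[i]) (F : set X).

Lemma cmeasurable_horner b (P : {poly R[i]}) : cmeasurable b ->
  cmeasurable (fun y => P.[b y]).
Proof.
move=> mb; elim/poly_ind: P => [|P c IH].
  by under eq_fun do rewrite horner0; exact: cmeasurable_cst.
under eq_fun do rewrite hornerMXaddC.
by apply: cmeasurableD; [exact: cmeasurableM|exact: cmeasurable_cst].
Qed.

Lemma horner_bounded (P : {poly R[i]}) (M : R) :
  exists M', forall z, normc z <= M -> normc P.[z] <= M'.
Proof.
elim/poly_ind: P => [|P c [M' IH]].
  by exists 0 => z _; rewrite horner0 normc0.
exists (M' * M + normc c) => z zM; rewrite hornerMXaddC.
rewrite (le_trans (ler_normcD _ _))// lerD2r normcM.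
by rewrite ler_pM ?normc_ge0// IH.
Qed.

Lemma cintegrable_bounded F f (M : R) : measurable F -> (mu F < +oo)%E ->
  cmeasurable f -> (forall y, F y -> normc (f y) <= M) -> cintegrable mu F f.
Proof.
move=> mF Foo mf fM.
apply: (@cintegrable_le _ _ _ _ _ _ (fun=> M)) => //.
apply: measurable_bounded_integrable => //.
exists `|M|; split; first exact: num_real.
by move=> x Mx y _; exact: ltW.
Qed.

(** The bound by the indicator encodes both the size of [f] and its vanishing off
    [F]; the latter puts the points away from [F] outside the support of [f]. *)
Definition test_function F f : Prop :=
  cmeasurable f /\ forall y, normc (f y) <= \1_F y.

Lemma test_function_off F f y : test_function F f -> ~ F y -> f y = 0.
Proof.
move=> [_ /(_ y)]; rewrite indicE => + Fy; rewrite memNset//= => f0.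
by apply: ComplexField.Normc.eq0_normc; apply/eqP; rewrite eq_le f0 normc_ge0.
Qed.

Lemma test_function_le1 F f y : test_function F f -> normc (f y) <= 1.
Proof.
by move=> [_ /(_ y)] /le_trans; apply; rewrite indicE; case: (_ \in _).
Qed.

(** The functionals are the integrals against test functions and the norm is that
    of [L^1(F)], pulled back along [b]; it is attained on the conjugate phase of
    [Q.[b y]].  The number [k] of test functions and the constant depend neither
    on [F] nor on [b]. *)
Lemma norming_test_functions F b (M : R) k : measurable F -> (mu F < +oo)%E ->
  cmeasurable b -> (forall y, F y -> normc (b y) <= M) ->
  exists2 fs : nat -> X -> R[i], (forall j, test_function F (fs j)) &
    forall Q : {poly R[i]}, (size Q <= k)%N ->
      \int[mu]_(y in F) normc Q.[b y] <=
      3 ^+ k * \sum_(j < k) normc (cintegral mu F (fun y => Q.[b y] * fs j y)).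
Proof.
move=> mF Foo mb bM.
have bounded P : exists M', forall y, F y -> normc P.[b y] <= M'.
  have [M' hM'] := horner_bounded P M.
  by exists M' => y Fy; exact/hM'/bM.
have iP P : cintegrable mu F (fun y => P.[b y]).
  have [M' hM'] := bounded P.
  by apply: cintegrable_bounded hM' => //; exact: cmeasurable_horner.
have inP P : mu.-integrable F (EFin \o (fun y => normc P.[b y])).
  exact: integrable_normc.
have le_f P f y : test_function F f -> normc (P.[b y] * f y) <= normc P.[b y].
  move=> tf; rewrite normcM -[leRHS]mulr1 ler_wpM2l ?normc_ge0//.
  exact: test_function_le1 tf.
have iPf P f : test_function F f -> cintegrable mu F (fun y => P.[b y] * f y).
  move=> tf; apply: cintegrable_le (inP P) _ => //.
    by case: tf => mf _; apply: cmeasurableM => //; exact: cmeasurable_horner.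
  by move=> y _; exact: le_f.
pose n (P : {poly R[i]}) := \int[mu]_(y in F) normc P.[b y].
pose phi (f : {f | test_function F f}) (P : {poly R[i]}) :=
  cintegral mu F (fun y => P.[b y] * sval f y).
have [|||||||fs [fsn _]] := @norming_functionals R _ n phi _ _ _ _ _ _ _ k.
- by move=> P; apply: Rintegral_ge0 => y _; exact: normc_ge0.
- move=> P Q; rewrite /n -RintegralD//; apply: le_Rintegral => //.
    rewrite /comp; under eq_fun do rewrite EFinD.
    by apply: integrableD => //; exact: inP.
  by move=> y _; rewrite hornerD ler_normcD.
- move=> a P; rewrite /n; under eq_Rintegral do rewrite hornerZ normcM.
  by rewrite RintegralZl.
- move=> f a P Q; rewrite /phi.
  under eq_cintegral do rewrite hornerD hornerZ mulrDl -mulrA.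
  rewrite cintegralD ?cintegralZ//.
  + exact/iPf/(svalP f).
  + exact/cintegrableZ/iPf/(svalP f).
  + exact/iPf/(svalP f).
- move=> f P; apply: normc_cintegral_le => //; first exact/iPf/(svalP f).
  by move=> y _; apply: le_f; exact: (svalP f).
- move=> P.
  have tf : test_function F (fun y => unphase P.[b y] * (\1_F y)%:C).
    split.
      apply: cmeasurableM.
        exact/cmeasurable_unphase/cmeasurable_horner.
      by apply: cmeasurable_real; exact: measurable_indic.
    move=> y; rewrite normcM normc_real ger0_norm// -[leRHS]mul1r.
    by rewrite ler_wpM2r// unphase_le1.
  exists (exist _ _ tf); rewrite /phi /=.
  rewrite (@eq_cintegral _ _ _ _ _ _ (fun y => (normc P.[b y])%:C)).
    apply: eq_ReIm; rewrite //=.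
    rewrite (@eq_Rintegral _ _ _ _ _ (cst 0)) => [|y _ /=]; last by [].
    by rewrite Rintegral_cst// mul0r.
  by move=> y yF; rewrite mulrA unphaseM indicE yF mulr1.
- have t0 : test_function F (fun=> 0).
    by split => [|y]; [exact: cmeasurable_cst|rewrite normc0].
  exists (exist _ _ t0) => P; rewrite /phi /=.
  under eq_cintegral do rewrite mulr0.
  by apply: eq_ReIm => /=; rewrite Rintegral_cst// mul0r.
exists (fun j => sval (fs j)) => [j|]; first exact: (svalP (fs j)).
exact: fsn.
Qed.

Lemma cintegral_supp F f : measurable F -> (forall y, ~ F y -> f y = 0) ->
  cintegral mu setT f = cintegral mu F f.
Proof.
move=> mF f0; rewrite /cintegral !(Rintegral_mkcond _ F).
by apply: eq_ReIm => /=; apply: eq_Rintegral => y _; rewrite patchE;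
  case: ifPn => // /negP yF; rewrite f0// => Fy; apply: yF; rewrite inE.
Qed.

Lemma cintegrable_supp F f : measurable F ->
  cintegrable mu setT f -> cintegrable mu F f.
Proof. by move=> mF [f1 f2]; split; apply: integrableS f1 || apply: integrableS f2. Qed.

Lemma wnorm_le (p M : R) (w : X -> R) F f : 0 < p -> measurable F ->
  measurable_fun setT w -> (forall x, 0 <= w x) -> cmeasurable f -> 0 <= M ->
  (forall y, normc (f y) <= M * \1_F y) ->
  (wnorm mu p w f <= ((M `^ p)%:E * \int[mu]_(x in F) (w x)%:E) `^ p^-1)%E.
Proof.
move=> p0 mF mw w0 mf M0 fM; rewrite /wnorm.
have mfw : measurable_fun setT (fun x => (normc (f x) `^ p * w x)%:E).
  apply/measurable_EFinP/measurable_funM => //.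
  by apply: (measurableT_comp (measurable_powR _)) => //; exact: measurable_normc.
have le : (\int[mu]_x (normc (f x) `^ p * w x)%:E <=
           (M `^ p)%:E * \int[mu]_(x in F) (w x)%:E)%E.
  rewrite -ge0_integralZl//; last 3 first.
  - by apply/measurable_EFinP; exact: measurable_funTS.
  - by move=> x _; rewrite lee_fin.
  - by rewrite lee_fin powR_ge0.
  rewrite [leRHS]integral_mkcond; apply: ge0_le_integral => //.
  - by move=> x _; rewrite lee_fin mulr_ge0 ?powR_ge0.
  - apply/(measurable_restrictT _ mF).
    apply: measurable_funTS; apply/measurable_EFinP.
    by apply: measurable_funM.
  - move=> x _; rewrite patchE; have := fM x; rewrite indicE.
    case: (x \in F) => /=; rewrite ?mulr1 ?mulr0 => fx.
      rewrite lee_fin ler_wpM2r//.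
      by rewrite ge0_ler_powR ?nnegrE ?normc_ge0 ?(ltW p0).
    have -> : normc (f x) = 0 by apply/eqP; rewrite eq_le fx normc_ge0.
    by rewrite powR0 ?gt_eqF// mul0r.
apply: gt0_ler_poweR le.
- by rewrite invr_ge0 ltW.
- rewrite in_itv /= leey andbT integral_ge0// => x _.
  by rewrite lee_fin mulr_ge0 ?powR_ge0.
- rewrite in_itv /= leey andbT mule_ge0 ?lee_fin ?powR_ge0// integral_ge0//.
  by move=> x _; rewrite lee_fin.
Qed.

End test_functions.

(** * Hölder's and Jensen's inequalities *)

Section hoelder_powers.
Context {R : realType} {d : measure_display} {X : measurableType d}.
Variable mu : {measure set X -> \bar R}.
Implicit Types (f g h w : X -> R) (D : set X).

Lemma measurable_fun_powR f s : measurable_fun setT f ->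
  measurable_fun setT (fun x => f x `^ s).
Proof. by move=> mf; exact: (measurableT_comp (measurable_powR _)). Qed.

Let hoelder_integral D f g (s : R) : measurable D ->
  measurable_fun setT f -> measurable_fun setT g ->
  (forall x, 0 <= f x) -> (forall x, 0 <= g x) -> 0 < s -> s < 1 ->
  (\int[mu]_(x in D) (f x `^ s * g x `^ (1 - s))%:E <=
   (\int[mu]_(x in D) (f x)%:E) `^ s * (\int[mu]_(x in D) (g x)%:E) `^ (1 - s))%E.
Proof.
move=> mD mf mg f0 g0 s0 s1.
have s1' : 0 < 1 - s by rewrite subr_gt0.
have mfs : measurable_fun setT ((fun x => f x `^ s) \_ D).
  by apply/(measurable_restrictT _ mD)/measurable_funTS/measurable_fun_powR.
have mgs : measurable_fun setT ((fun x => g x `^ (1 - s)) \_ D).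
  by apply/(measurable_restrictT _ mD)/measurable_funTS/measurable_fun_powR.
have Nf (h : X -> R) (t : R) : (forall x, 0 <= h x) -> 0 < t ->
    (Lnorm mu (t^-1)%:E (EFin \o ((fun x => h x `^ t)%R \_ D)) =
     (\int[mu]_(x in D) (h x)%:E) `^ t)%E.
  move=> h0 t0; rewrite unlock invrK; congr (_ `^ _)%E.
  rewrite [RHS]integral_mkcond; apply: eq_integral => x _ /=.
  rewrite !patchE; case: ifP => _.
    by rewrite ger0_norm ?powR_ge0// -powRrM mulfV ?gt_eqF// powRr1.
  by rewrite normr0 powR0// invr_neq0// gt_eqF.
rewrite -(Nf f s f0 s0) -(Nf g (1 - s) g0 s1').
have := @hoelder _ _ _ mu _ _ s^-1 (1 - s)^-1 mfs mgs.
rewrite !invr_gt0 !invrK s0 s1' (addrC s) subrK => /(_ isT isT erefl).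
rewrite Lnorm1; apply: le_trans.
rewrite [leLHS]integral_mkcond.
rewrite le_eqVlt; apply/orP; left; apply/eqP; apply: eq_integral => x _ /=.
rewrite !patchE; case: ifP => _; rewrite ?mulr0 ?normr0//.
by rewrite ger0_norm// mulr_ge0 ?powR_ge0.
Qed.

(** Hölder's inequality with the powers [s] and [1 - s] on the left-hand side, the
    form in which [Ap] weights enter. *)
Lemma hoelder_le D f g h (s a b : R) : measurable D ->
  measurable_fun setT f -> measurable_fun setT g -> measurable_fun setT h ->
  (forall x, 0 <= f x) -> (forall x, 0 <= g x) -> (forall x, 0 <= h x) ->
  0 < s -> s <= 1 -> 0 <= a -> 0 <= b ->
  (\int[mu]_(x in D) (f x)%:E <= a%:E)%E ->
  (\int[mu]_(x in D) (g x)%:E <= b%:E)%E ->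
  {ae mu, forall x, D x -> h x <= f x `^ s * g x `^ (1 - s)} ->
  (\int[mu]_(x in D) (h x)%:E <= (a `^ s * b `^ (1 - s))%:E)%E.
Proof.
move=> mD mf mg mh f0 g0 h0 s0 s1 a0 b0 fa gb hfg.
apply: (@le_trans _ _ (\int[mu]_(x in D) (f x `^ s * g x `^ (1 - s))%:E)%E).
  apply: ae_ge0_le_integral => //.
  - by move=> x _; rewrite lee_fin.
  - by apply/measurable_EFinP; exact: measurable_funTS.
  - by move=> x _; rewrite lee_fin mulr_ge0 ?powR_ge0.
  - apply/measurable_EFinP/measurable_funTS/measurable_funM;
      exact: measurable_fun_powR.
have := s1; rewrite le_eqVlt => /predU1P[s1e|s1'].
  rewrite s1e subrr !powRr0 powRr1// mulr1.
  by under eq_integral do rewrite powRr1// powRr0 mulr1.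
rewrite (le_trans (hoelder_integral mD mf mg f0 g0 s0 s1'))//.
rewrite EFinM -!poweR_EFin lee_pmul ?poweR_ge0//.
- apply: gt0_ler_poweR fa; rewrite ?(ltW s0)//.
  + by rewrite in_itv /= leey andbT integral_ge0// => x _; rewrite lee_fin.
  + by rewrite in_itv /= leey andbT lee_fin.
- apply: gt0_ler_poweR gb; rewrite ?subr_ge0//.
  + by rewrite in_itv /= leey andbT integral_ge0// => x _; rewrite lee_fin.
  + by rewrite in_itv /= leey andbT lee_fin.
Qed.

Lemma jensen_powR D f h (s a v : R) : measurable D -> mu D = v%:E ->
  measurable_fun setT f -> measurable_fun setT h ->
  (forall x, 0 <= f x) -> (forall x, 0 <= h x) -> 0 < s -> s <= 1 -> 0 <= a ->
  (\int[mu]_(x in D) (f x)%:E <= a%:E)%E ->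
  {ae mu, forall x, D x -> h x <= f x `^ s} ->
  (\int[mu]_(x in D) (h x)%:E <= (a `^ s * v `^ (1 - s))%:E)%E.
Proof.
move=> mD muD mf mh f0 h0 s0 s1 a0 fa hf.
have v0 : 0 <= v by rewrite -lee_fin -muD.
apply: (hoelder_le (g := cst 1) mD mf) => //.
  by rewrite -[leLHS]/(\int[mu]_(x in D) (cst 1%:E) x)%E integral_cst// mul1e muD.
by apply: filterS hf => x hx /hx; rewrite /= powR1 mulr1.
Qed.

Lemma jensen_exprn D h n (a v : R) : measurable D -> mu D = v%:E ->
  measurable_fun setT h -> (forall x, 0 <= h x) -> (0 < n)%N -> 0 <= a ->
  (\int[mu]_(x in D) (h x ^+ n)%:E <= a%:E)%E ->
  (\int[mu]_(x in D) (h x)%:E < +oo)%E /\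
  fine (\int[mu]_(x in D) (h x)%:E) ^+ n <= a * v ^+ n.-1.
Proof.
move=> mD muD mh h0 n0 a0 ha.
have v0 : 0 <= v by rewrite -lee_fin -muD.
have n0' : 0 < n%:R :> R by rewrite ltr0n.
have mhn : measurable_fun setT (fun x => h x ^+ n) by exact: measurable_funX.
have := @jensen_powR D (fun x => h x ^+ n) h (n%:R^-1) a v mD muD mhn mh.
move=> /(_ (fun x => exprn_ge0 _ (h0 x)) h0).
rewrite invr_gt0 n0' invf_le1// ler1n n0 => /(_ isT isT a0 ha).
have hae : {ae mu, forall x, D x -> h x <= (h x ^+ n) `^ n%:R^-1}.
  apply/aeW => x _; rewrite -powR_mulrn// -powRrM mulfV ?gt_eqF//.
  by rewrite powRr1.
move=> /(_ hae) hint.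
have i0 : (0 <= \int[mu]_(x in D) (h x)%:E)%E.
  by apply: integral_ge0 => x _; rewrite lee_fin.
have fin : (\int[mu]_(x in D) (h x)%:E < +oo)%E.
  by rewrite (le_lt_trans hint)// ltry.
split => //.
have {hint} : fine (\int[mu]_(x in D) (h x)%:E) <=
    a `^ n%:R^-1 * v `^ (1 - n%:R^-1).
  by rewrite -lee_fin fineK// ge0_fin_numE.
move=> /(lerXn2r n); rewrite !nnegrE fine_ge0// mulr_ge0 ?powR_ge0//.
move=> /(_ isT isT) /le_trans; apply.
rewrite exprMn -!powR_mulrn ?powR_ge0// -!powRrM mulVf ?gt_eqF// powRr1//.
by rewrite mulrBl mul1r mulVf ?gt_eqF// -subn1 natrB.
Qed.

End hoelder_powers.

(** * Balls in a space of homogeneous type *)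

Section balls.
Context {R : realType} {d : measure_display} {X : measurableType d}.
Variables (rho : X -> X -> R) (A0 : R) (mu : {measure set X -> \bar R}).
Hypothesis hX : homogeneous_type rho A0 mu.

Lemma measurable_qball x r : measurable (qball rho x r).
Proof. by case: hX. Qed.

Lemma A0_ge1 : 1 <= A0.
Proof. by case: hX => -[]. Qed.

Lemma rho_ge0 x y : 0 <= rho x y.
Proof. by case: hX => -[]. Qed.

Lemma rhoxx x : rho x x = 0.
Proof. by case: hX => -[_ _ h _ _] _ _ _; exact/h. Qed.

Lemma rhoC x y : rho x y = rho y x.
Proof. by case: hX => -[]. Qed.

Lemma rho_triangle x y z : rho x y <= A0 * (rho x z + rho z y).
Proof. by case: hX => -[]. Qed.

Lemma subset_qball x r s : r <= s -> qball rho x r `<=` qball rho x s.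
Proof. by move=> rs y /= /lt_le_trans; exact. Qed.

Lemma mu_qball_lty x r : 0 < r -> (mu (qball rho x r) < +oo)%E.
Proof. by move=> r0; case: hX => _ _ _ [C /(_ x r r0)[]]. Qed.

Lemma mu_qball x r : 0 < r -> mu (qball rho x r) = (vball rho mu x r)%:E.
Proof. by move=> r0; rewrite fineK// ge0_fin_numE ?mu_qball_lty. Qed.

(** A null ball would make all its dilates null, hence the whole space. *)
Lemma vball_gt0 x r : 0 < r -> 0 < vball rho mu x r.
Proof.
move=> r0; rewrite lt_neqAle fine_ge0// andbT eq_sym; apply/eqP => v0.
have mu0 n : mu (qball rho x (2 ^+ n * r)) = 0%E.
  elim: n => [|n IH]; first by rewrite mul1r mu_qball// v0.
  case: hX => _ _ _ [C /(_ x (2 ^+ n * r))].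
  rewrite mulr_gt0 ?exprn_gt0// => /(_ isT)[+ _].
  rewrite IH mule0 mulrA -exprS => le0.
  by apply/eqP; rewrite eq_le le0 measure_ge0.
have := hX; case => _ _ /eqP + _; apply.
have -> : [set: X] = \bigcup_n qball rho x (2 ^+ n * r).
  apply/seteqP; split => // y _.
  have [n hn] : exists n : nat, rho x y / r < n%:R.
    by exists (Num.trunc (rho x y / r)).+1; exact: truncnS_gt.
  exists n => //; rewrite /qball /= -ltr_pdivrMr// (lt_le_trans hn)//.
  by rewrite -natrX ler_nat ltnW// ltn_expl.
apply: measure_negligible.
  by apply: bigcup_measurable => n _; exact: measurable_qball.
apply: negligible_bigcup => n; apply/negligibleP; first exact: measurable_qball.
exact: mu0.
Qed.

Lemma ler_vball x y r s : 0 < s -> qball rho x r `<=` qball rho y s ->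
  vball rho mu x r <= vball rho mu y s.
Proof.
move=> s0 rs; have le_mu : (mu (qball rho x r) <= mu (qball rho y s))%E.
  by rewrite le_measure ?inE//; exact: measurable_qball.
have lty := mu_qball_lty y s0.
have lty' := le_lt_trans le_mu lty.
by apply: fine_le le_mu; rewrite ge0_fin_numE.
Qed.

Lemma vball_doubling (t : R) : exists2 D : R, 1 <= D & forall x r, 0 < r ->
  vball rho mu x (t * r) <= D * vball rho mu x r.
Proof.
have [C C1 hC] : exists2 C : R, 1 <= C & forall x r, 0 < r ->
    vball rho mu x (2 * r) <= C * vball rho mu x r.
  case: hX => _ _ _ [C hC]; exists (Num.max 1 C); first by rewrite le_max lexx.
  move=> x r r0; have [+ _] := hC x r r0.
  rewrite !mu_qball ?mulr_gt0// -EFinM lee_fin => /le_trans; apply.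
  by rewrite ler_wpM2r ?le_max ?lexx ?orbT// ltW// vball_gt0.
have [n tn] : exists n : nat, t <= 2 ^+ n.
  exists (Num.trunc t).+1; rewrite ltW// (lt_trans (truncnS_gt _))//.
  by rewrite -natrX ltr_nat ltn_expl.
exists (C ^+ n) => [|x r r0]; first exact: exprn_ege1.
apply: (@le_trans _ _ (vball rho mu x (2 ^+ n * r))).
  apply: ler_vball; first by rewrite mulr_gt0 ?exprn_gt0.
  by apply: subset_qball; rewrite ler_wpM2r// ltW.
elim: n {tn} => [|n IH]; first by rewrite !mul1r.
rewrite !exprS -!mulrA (le_trans (hC _ _ _)) ?mulr_gt0 ?exprn_gt0//.
by rewrite ler_wpM2l// (le_trans _ C1).
Qed.

(** The ball centred at [y] lies in a dilate of the one centred at [x] by a factor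
    that does not depend on the scale [r]. *)
Lemma vball_comparable (s t : R) : exists2 D : R, 1 <= D &
  forall x y r, 0 < r -> rho x y <= s * r ->
    vball rho mu y (t * r) <= D * vball rho mu x r.
Proof.
have A0gt0 : 0 < A0 by rewrite (lt_le_trans _ A0_ge1).
have [D D1 hD] := vball_doubling (A0 * (`|s| + `|t| + 1)).
exists D => // x y r r0 xy; rewrite (le_trans _ (hD x r r0))//.
apply: ler_vball => [|z yz]; first by rewrite !mulr_gt0// ltr_wpDl ?addr_ge0.
move: yz; rewrite /qball /= => yz; rewrite (le_lt_trans (rho_triangle x z y))// -mulrA ltr_pM2l//.
have sr : s * r <= `|s| * r by rewrite ler_wpM2r ?ler_norm// ltW.
have tr : t * r <= `|t| * r by rewrite ler_wpM2r ?ler_norm// ltW.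
by rewrite !mulrDl mul1r; move: yz; lra.
Qed.

End balls.

(** * Weights *)

Section weights.
Context {R : realType} {d : measure_display} {X : measurableType d}.
Variables (rho : X -> X -> R) (A0 : R) (mu : {measure set X -> \bar R}).
Hypothesis hX : homogeneous_type rho A0 mu.
Implicit Types (w l : X -> R) (B : set X).

Local Notation ball := (qball rho).
Local Notation vol := (vball rho mu).

Lemma integral_gt0 w B : measurable B -> (0 < mu B)%E ->
  measurable_fun setT w -> (forall x, 0 <= w x) -> {ae mu, forall x, 0 < w x} ->
  (0 < \int[mu]_(x in B) (w x)%:E)%E.
Proof.
move=> mB B0 mw w0 wpos; rewrite lt0e; apply/andP; split; last first.
  by apply: integral_ge0 => x _; rewrite lee_fin.
apply/eqP => iw0.
have mwB : measurable_fun B (EFin \o w).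
  by apply/measurable_EFinP; exact: measurable_funTS.
have /(ae_eq_integral_abs mu mB mwB) w0ae : (\int[mu]_(x in B) `|(EFin \o w) x| = 0)%E.
  by rewrite -[RHS]iw0; apply: eq_integral => x _ /=; rewrite ger0_norm.
have /negligibleP : mu.-negligible B.
  have : {ae mu, forall x, ~ B x}.
    by apply: filterS2 wpos w0ae => x w0x + Bx => /(_ Bx) [] e; rewrite e ltxx in w0x.
  by apply: negligibleS => x Bx; apply.
by move=> /(_ mB) e; rewrite e ltxx in B0.
Qed.

Lemma avg_real w x r L : 0 < r -> (\int[mu]_(y in ball x r) (w y)%:E = L%:E)%E ->
  avg mu (ball x r) w = (L / vol x r)%:E.
Proof.
move=> r0 wL; rewrite /avg wL (mu_qball hX)// inver.
by rewrite gt_eqF ?(vball_gt0 hX).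
Qed.

Lemma ge0_integral_real w B : (forall x, 0 <= w x) ->
  (\int[mu]_(x in B) (w x)%:E < +oo)%E ->
  exists2 L, 0 <= L & (\int[mu]_(x in B) (w x)%:E = L%:E)%E.
Proof.
move=> w0 woo; exists (fine (\int[mu]_(x in B) (w x)%:E)).
  by apply: fine_ge0; apply: integral_ge0 => x _; rewrite lee_fin.
by rewrite fineK// ge0_fin_numE// integral_ge0// => x _; rewrite lee_fin.
Qed.

(** The exponents add up to [1], so that integrals can be traded for means. *)
Lemma powR_mean (L L' v t : R) : 0 <= L -> 0 <= L' -> 0 < v ->
  L `^ t * L' `^ (1 - t) = (L / v) `^ t * (L' / v) `^ (1 - t) * v.
Proof.
move=> L0 L'0 v0; have vn0 : v != 0 by rewrite gt_eqF.
rewrite -[in LHS](divfK vn0 L) -[in LHS](divfK vn0 L').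
rewrite (@powRM _ (L / v)) ?(@powRM _ (L' / v)) ?divr_ge0 ?(ltW v0)//.
rewrite mulrACA; congr (_ * _).
by rewrite -powRD ?(addrC t) ?subrK ?powRr1 ?(ltW v0) ?gt_eqF// oner_eq0.
Qed.

Definition dual_weight (p : R) w x := w x `^ (- (p - 1)^-1).

Lemma dual_weight_powR p w x : 1 < p ->
  dual_weight p w x `^ (1 - p^-1) = w x `^ (- p^-1).
Proof.
move=> p1; rewrite /dual_weight -powRrM; congr (_ `^ _).
have p0 : p != 0 by rewrite gt_eqF// (lt_trans ltr01).
by field; rewrite p0 subr_eq0 gt_eqF.
Qed.

(** The [Ap] condition raised to the power [p^-1].  The positivity of the integral
    of [w] is what makes the integral of the dual weight finite. *)
Lemma Ap_ball p w : 1 < p -> Ap rho mu p w -> exists2 A, 0 < A &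
  forall x r, 0 < r -> exists L L', [/\ 0 <= L, 0 <= L',
    (\int[mu]_(y in ball x r) (w y)%:E = L%:E)%E,
    (\int[mu]_(y in ball x r) (dual_weight p w y)%:E = L'%:E)%E &
    L `^ p^-1 * L' `^ (1 - p^-1) <= A * vol x r].
Proof.
move=> p1 [[mw w0 wpos wint] wA].
have p0 : 0 < p by rewrite (lt_trans ltr01).
have p1' : 0 < p - 1 by rewrite subr_gt0.
have [Z Z0 hZ] : exists2 Z, 0 < Z & (Ap_const rho mu p w <= Z%:E)%E.
  exists (Num.max 1 (fine (Ap_const rho mu p w))); first by rewrite lt_max ltr01.
  move: wA; case: (Ap_const _ _ _ _) => [z _|//|_]; last by rewrite leNye.
  by rewrite lee_fin le_max lexx orbT.
exists (Z `^ p^-1) => [|x r r0]; first exact: powR_gt0.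
have v0 := vball_gt0 hX x r0.
have mB := measurable_qball hX x r.
have [L L0 wL] := ge0_integral_real w0 (wint x r r0).
have Lpos : 0 < L.
  by rewrite -lte_fin -wL integral_gt0// (mu_qball hX)// lte_fin.
have : (avg mu (ball x r) w * avg mu (ball x r) (dual_weight p w) `^ (p - 1)
        <= Z%:E)%E.
  apply: le_trans hZ; apply: ereal_sup_ubound; exists x, r; split => //.
rewrite (avg_real r0 wL) => hx.
have w'0 y : 0 <= dual_weight p w y by exact: powR_ge0.
have [|L' L'0 wL'] := @ge0_integral_real (dual_weight p w) (ball x r) w'0.
  rewrite ltNge leye_eq; apply/negP => /eqP e; move: hx.
  rewrite {1}/avg e (mu_qball hX)// inver gt_eqF// gt0_mulye ?lte_fin ?invr_gt0//.
  rewrite poweRyr ?gt_eqF// gt0_muley ?lte_fin ?divr_gt0//.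
exists L, L'; split => //; move: hx.
rewrite (avg_real r0 wL') poweR_EFin -EFinM lee_fin => hx.
rewrite (powR_mean _ L0 L'0 v0) ler_wpM2r ?(ltW v0)//.
have -> : (L' / vol x r) `^ (1 - p^-1) = ((L' / vol x r) `^ (p - 1)) `^ p^-1.
  by rewrite -powRrM mulrBl mulfV ?gt_eqF// mul1r.
rewrite -powRM ?powR_ge0 ?divr_ge0 ?(ltW v0)//.
apply: (ge0_ler_powR _ _ _ hx); rewrite ?nnegrE ?invr_ge0 ?(ltW p0) ?(ltW Z0)//.
by rewrite mulr_ge0 ?powR_ge0 ?divr_ge0 ?(ltW v0).
Qed.

Section bloom.
Variables (p : R) (l1 l2 : X -> R).
Hypotheses (p1 : 1 < p) (l1A : Ap rho mu p l1) (l2A : Ap rho mu p l2).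

Definition bloom_weight x := l1 x `^ p^-1 * l2 x `^ (- p^-1).

Let p0 : 0 < p. Proof. by rewrite (lt_trans ltr01). Qed.
Let ml1 : measurable_fun setT l1. Proof. by case: l1A => -[]. Qed.
Let ml2 : measurable_fun setT l2. Proof. by case: l2A => -[]. Qed.
Let l1_ge0 x : 0 <= l1 x. Proof. by case: l1A => -[]. Qed.
Let l2_ge0 x : 0 <= l2 x. Proof. by case: l2A => -[]. Qed.
Let th0 : 0 < p^-1. Proof. by rewrite invr_gt0. Qed.
Let th1 : p^-1 <= 1. Proof. by rewrite invf_le1// ltW. Qed.

Lemma measurable_bloom_weight : measurable_fun setT bloom_weight.
Proof. by apply: measurable_funM; exact: measurable_fun_powR. Qed.

Lemma bloom_weight_ge0 x : 0 <= bloom_weight x.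
Proof. by rewrite mulr_ge0 ?powR_ge0. Qed.

Lemma bloom_weight_gt0 : {ae mu, forall x, 0 < bloom_weight x}.
Proof.
case: l1A l2A => -[_ _ l1pos _] _ [[_ _ l2pos _] _].
by apply: filterS2 l1pos l2pos => x l1x l2x; rewrite mulr_gt0 ?powR_gt0.
Qed.

(** The inverse of [bloom_weight] is the product of [l2 `^ p^-1] and of the dual of
    [l1] to the power [1 - p^-1], so Hölder's inequality bounds its integral by
    the two factors that the [Ap] conditions of [l2] and [l1] pair with those of
    the last inequality.  That inequality is stronger than an [A2] condition on
    [bloom_weight]: it is also an upper bound for the product that testing the
    commutator on a ball produces. *)
Lemma bloom_ball : exists2 A, 0 < A & forall x r, 0 < r -> exists L L' J,
  [/\ 0 <= L /\ 0 <= L', 0 <= J,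
    (\int[mu]_(y in ball x r) (l1 y)%:E = L%:E)%E /\
    (\int[mu]_(y in ball x r) (dual_weight p l2 y)%:E = L'%:E)%E,
    (\int[mu]_(y in ball x r) ((bloom_weight y)^-1)%:E = J%:E)%E /\
    (\int[mu]_(y in ball x r) (bloom_weight y)%:E
      <= (L `^ p^-1 * L' `^ (1 - p^-1))%:E)%E &
    L `^ p^-1 * L' `^ (1 - p^-1) * J <= A * vol x r ^+ 2].
Proof.
have [A1 A10 hA1] := Ap_ball p1 l1A.
have [A2 A20 hA2] := Ap_ball p1 l2A.
exists (A1 * A2) => [|x r r0]; first exact: mulr_gt0.
have v0 := vball_gt0 hX x r0.
have mB := measurable_qball hX x r.
have [L1 [L1' [L10 L1'0 iL1 iL1' h1]]] := hA1 x r r0.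
have [L2 [L2' [L20 L2'0 iL2 iL2' h2]]] := hA2 x r r0.
have nuV y : (bloom_weight y)^-1 =
    l2 y `^ p^-1 * dual_weight p l1 y `^ (1 - p^-1).
  by rewrite dual_weight_powR// /bloom_weight invfM !powRN invrK mulrC.
have mnuV : measurable_fun setT (fun y => (bloom_weight y)^-1).
  under eq_fun do rewrite nuV.
  apply: measurable_funM; first exact: measurable_fun_powR.
  exact/measurable_fun_powR/measurable_fun_powR.
have hJ : (\int[mu]_(y in ball x r) ((bloom_weight y)^-1)%:E <=
    (L2 `^ p^-1 * L1' `^ (1 - p^-1))%:E)%E.
  apply: (@hoelder_le _ _ _ _ _ l2 (dual_weight p l1)) => //.
  - exact: measurable_fun_powR.
  - by move=> y; exact: powR_ge0.
  - by move=> y; rewrite invr_ge0 bloom_weight_ge0.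
  - by rewrite iL2.
  - by rewrite iL1'.
  - by apply/aeW => y _; rewrite nuV.
have hnu : (\int[mu]_(y in ball x r) (bloom_weight y)%:E <=
    (L1 `^ p^-1 * L2' `^ (1 - p^-1))%:E)%E.
  apply: (@hoelder_le _ _ _ _ _ l1 (dual_weight p l2)) => //.
  - exact: measurable_fun_powR.
  - exact: measurable_bloom_weight.
  - by move=> y; exact: powR_ge0.
  - exact: bloom_weight_ge0.
  - by rewrite iL1.
  - by rewrite iL2'.
  - by apply/aeW => y _; rewrite dual_weight_powR.
have [||J J0 iJ] := @ge0_integral_real (fun y => (bloom_weight y)^-1) (ball x r).
- by move=> y; rewrite invr_ge0 bloom_weight_ge0.
- by rewrite (le_lt_trans hJ) ?ltry.
exists L1, L2', J; split => //.
move: hJ; rewrite iJ lee_fin => hJ.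
have h12 : L1 `^ p^-1 * L2' `^ (1 - p^-1) * (L2 `^ p^-1 * L1' `^ (1 - p^-1))
    <= A1 * A2 * vol x r ^+ 2.
  rewrite expr2 [leRHS]mulrACA [leLHS](_ : _ =
    (L1 `^ p^-1 * L1' `^ (1 - p^-1)) * (L2 `^ p^-1 * L2' `^ (1 - p^-1))); last ring.
  by rewrite ler_pM ?mulr_ge0 ?powR_ge0.
by apply: le_trans h12; rewrite ler_wpM2l// mulr_ge0 ?powR_ge0.
Qed.

Variable m : nat.
Hypothesis m_gt0 : (0 < m)%N.

Definition bloom_root x := bloom_weight x `^ m%:R^-1.

Let m0 : 0 < m%:R :> R. Proof. by rewrite ltr0n. Qed.
Let m'0 : 0 < m%:R^-1 :> R. Proof. by rewrite invr_gt0. Qed.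
Let m'1 : m%:R^-1 <= 1 :> R. Proof. by rewrite invf_le1// ler1n. Qed.

Lemma measurable_bloom_root : measurable_fun setT bloom_root.
Proof. exact/measurable_fun_powR/measurable_bloom_weight. Qed.

Lemma weight_bloom_root : weight rho mu bloom_root.
Proof.
split.
- exact: measurable_bloom_root.
- by move=> x; exact: powR_ge0.
- by apply: filterS bloom_weight_gt0 => x; exact: powR_gt0.
- move=> x r r0; have [A _ /(_ x r r0)] := bloom_ball.
  move=> [L [L' [J [[L0 L'0] _ _ [_ hnu] _]]]].
  apply: le_lt_trans (ltry _).
  apply: (jensen_powR (s := m%:R^-1) (f := bloom_weight) (measurable_qball hX x r)
    (mu_qball hX x r0)) hnu _ => //.
  + exact: measurable_bloom_weight.
  + exact: measurable_bloom_root.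
  + exact: bloom_weight_ge0.
  + by move=> y; exact: powR_ge0.
  + by rewrite mulr_ge0 ?powR_ge0.
  + by apply/aeW => y _.
Qed.

(** Hölder's inequality for
    [1 = (nu^(1/m))^(m/(m+1)) * (nu^-1)^(1/(m+1))]. *)
Lemma vball_le_bloom_root x r J N : 0 < r -> 0 <= J -> 0 <= N ->
  (\int[mu]_(y in ball x r) ((bloom_weight y)^-1)%:E = J%:E)%E ->
  (\int[mu]_(y in ball x r) (bloom_root y)%:E = N%:E)%E ->
  vol x r ^+ m.+1 <= N ^+ m * J.
Proof.
move=> r0 J0 N0 iJ iN.
have v0 := vball_gt0 hX x r0.
pose s : R := m%:R / m.+1%:R.
have mS0 : 0 < m.+1%:R :> R by rewrite ltr0n.
have s' : 1 - s = m.+1%:R^-1.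
  by rewrite /s -natr1; field; rewrite natr1 gt_eqF.
have mnuV : measurable_fun setT (fun y => (bloom_weight y)^-1).
  have -> : (fun y => (bloom_weight y)^-1) = (fun y => bloom_weight y `^ (-1)).
    by apply/funext => y; rewrite powR_inv1// bloom_weight_ge0.
  exact/measurable_fun_powR/measurable_bloom_weight.
have : (\int[mu]_(y in ball x r) (cst 1 y)%:E <= (N `^ s * J `^ (1 - s))%:E)%E.
  apply: (@hoelder_le _ _ _ _ _ bloom_root (fun y => (bloom_weight y)^-1)) => //.
  - exact: measurable_qball hX x r.
  - exact: measurable_bloom_root.
  - by move=> y; exact: powR_ge0.
  - by move=> y; rewrite invr_ge0 bloom_weight_ge0.
  - by rewrite divr_gt0.
  - by rewrite ler_pdivrMr// mul1r ler_nat.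
  - by rewrite iN.
  - by rewrite iJ.
  - apply: filterS bloom_weight_gt0 => y nu0 _.
    rewrite s' /bloom_root -powRrM -(powR_inv1 (bloom_weight_ge0 y)) -powRrM -powRD.
      rewrite (_ : _ + _ = 0) ?powRr0// /s.
      by field; rewrite !gt_eqF.
    by apply/implyP => _; rewrite gt_eqF.
rewrite -[X in (X <= _)%E]/(\int[mu]_(y in ball x r) (cst 1%:E) y)%E.
rewrite integral_cst ?mul1e ?(mu_qball hX)//; last exact: measurable_qball hX x r.
rewrite lee_fin => /(lerXn2r m.+1).
rewrite !nnegrE (ltW v0) mulr_ge0 ?powR_ge0// => /(_ isT isT) /le_trans; apply.
rewrite exprMn -!powR_mulrn ?powR_ge0// -!powRrM s' mulVf ?gt_eqF// powRr1//.
by rewrite /s mulfVK ?gt_eqF.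
Qed.

(** Jensen's inequality for the concave power [m%:R^-1], applied to [bloom_weight]
    and to its inverse. *)
Lemma Ap_bloom_root : Ap rho mu 2 bloom_root.
Proof.
split; first exact: weight_bloom_root.
have [A A0' hA] := bloom_ball.
apply: (@le_lt_trans _ _ (A `^ m%:R^-1)%:E); last exact: ltry.
apply: ge_ereal_sup => _ [x [r [r0 ->]]].
have v0 := vball_gt0 hX x r0.
have mB := measurable_qball hX x r.
have [L [L' [J [[L0 L'0] J0 _ [iJ hnu] hLJ]]]] := hA x r r0.
set N := L `^ p^-1 * L' `^ (1 - p^-1) in hnu hLJ.
have N0 : 0 <= N by rewrite mulr_ge0 ?powR_ge0.
have i1 : (\int[mu]_(y in ball x r) (bloom_root y)%:E <=
    (N `^ m%:R^-1 * vol x r `^ (1 - m%:R^-1))%:E)%E.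
  apply: (jensen_powR (s := m%:R^-1) (f := bloom_weight) mB (mu_qball hX x r0)) hnu _ => //.
  - exact: measurable_bloom_weight.
  - exact: measurable_bloom_root.
  - exact: bloom_weight_ge0.
  - by move=> y; exact: powR_ge0.
  - by apply/aeW => y _.
have rootV y : bloom_root y `^ (- (2 - 1)^-1) = (bloom_weight y)^-1 `^ m%:R^-1.
  rewrite (_ : 2 - 1 = 1 :> R); last ring.
  by rewrite invr1 /bloom_root -powRAC powR_inv1 ?bloom_weight_ge0.
have i2 : (\int[mu]_(y in ball x r) (bloom_root y `^ (- (2 - 1)^-1))%:E <=
    (J `^ m%:R^-1 * vol x r `^ (1 - m%:R^-1))%:E)%E.
  apply: (jensen_powR (s := m%:R^-1) (f := fun y => (bloom_weight y)^-1) mB (mu_qball hX x r0))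
    => //.
  - have -> : (fun y => (bloom_weight y)^-1) = (fun y => bloom_weight y `^ (-1)).
      by apply/funext => y; rewrite powR_inv1// bloom_weight_ge0.
    exact/measurable_fun_powR/measurable_bloom_weight.
  - exact/measurable_fun_powR/measurable_bloom_root.
  - by move=> y; rewrite invr_ge0 bloom_weight_ge0.
  - by move=> y; exact: powR_ge0.
  - by rewrite iJ.
  - by apply/aeW => y _; rewrite rootV.
have [||N1 N10 e1] := @ge0_integral_real bloom_root (ball x r).
- by move=> y; exact: powR_ge0.
- exact: le_lt_trans i1 (ltry _).
have [||N2 N20 e2] :=
  @ge0_integral_real (fun y => bloom_root y `^ (- (2 - 1)^-1)) (ball x r).
- by move=> y; exact: powR_ge0.
- exact: le_lt_trans i2 (ltry _).
move: i1 i2; rewrite e1 e2 !lee_fin => i1 i2.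
rewrite (avg_real r0 e1) (avg_real r0 e2) (_ : (2 - 1 = 1 :> R)%R); last ring.
rewrite poweR_EFin powRr1 ?divr_ge0 ?(ltW v0)// -EFinM lee_fin.
rewrite mulrACA -invfM -expr2 ler_pdivrMr ?exprn_gt0//.
rewrite (le_trans (ler_pM _ _ i1 i2))//.
rewrite mulrACA -powRM// -powRD; last by apply/implyP => _; rewrite gt_eqF.
have hA' : (N * J) `^ m%:R^-1 <= (A * vol x r ^+ 2) `^ m%:R^-1.
  apply: (ge0_ler_powR _ _ _ hLJ); first exact: ltW.
  - by rewrite nnegrE mulr_ge0.
  - by rewrite nnegrE mulr_ge0 ?exprn_ge0 ?ltW.
rewrite (le_trans (ler_wpM2r _ hA')) ?powR_ge0//.
rewrite powRM ?exprn_ge0 ?(ltW v0) ?(ltW A0')// -mulrA ler_wpM2l ?powR_ge0//.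
rewrite -powR_mulrn ?(ltW v0)// -powRrM -powRD; last by apply/implyP => _; rewrite gt_eqF.
rewrite (_ : _ + _ = 2)// ; last by ring.
Qed.

End bloom.

End weights.

(** * Iterated commutators as integral operators *)

Section iterated_commutator.
Context {R : realType} {d : measure_display} {X : measurableType d}.
Variable mu : {measure set X -> \bar R}.
Implicit Types (b f : X -> R[i]) (T : (X -> R[i]) -> X -> R[i]).

Lemma cmeasurable_iter_commutator b T m f : cmeasurable b ->
  (forall g, in_L2 mu g -> cmeasurable (T g)) ->
  commutator_dom mu m b f -> cmeasurable (iter_commutator m b T f).
Proof.
move=> mb mT; elim: m f => [|m IH] f fdom.
  apply: mT; have := fdom 0 (leqnn _).
  by under eq_fun do rewrite expr0 mul1r.
apply: cmeasurableB.
  by apply: cmeasurableM => //; apply: IH => j jm; apply: fdom; rewrite leqW.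
apply: IH => j jm; have := fdom j.+1 jm.
by under eq_fun do rewrite exprSr -mulrA.
Qed.

(** One more commutator subtracts from [b x] times the formula for [f] the formula
    for [b * f], which turns the factor [(b x - b y) ^+ m] into the next power. *)
Lemma iter_commutator_kernel b T (k : X -> R[i]) x m f :
  (forall j, (j <= m)%N ->
     cintegrable mu setT (fun y => k y * (b y ^+ j * f y)) /\
     T (fun y => b y ^+ j * f y) x =
       cintegral mu setT (fun y => k y * (b y ^+ j * f y))) ->
  cintegrable mu setT (fun y => k y * ((b x - b y) ^+ m * f y)) /\
  iter_commutator m b T f x =
    cintegral mu setT (fun y => k y * ((b x - b y) ^+ m * f y)).
Proof.
elim: m f => [|m IH] f Tf.
  have := Tf 0 (leqnn _).
  have -> : (fun y => b y ^+ 0 * f y) = f.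
    by apply/funext => y; rewrite expr0 mul1r.
  by under [in X in _ -> X]eq_fun do rewrite expr0 mul1r;
    under eq_fun do rewrite expr0 mul1r.
have [i1 e1] := IH f (fun j jm => Tf j (leqW jm)).
have [|i2 e2] := IH (fun y => b y * f y).
  move=> j jm; have := Tf j.+1 jm.
  have -> : (fun y => b y ^+ j.+1 * f y) = (fun y => b y ^+ j * (b y * f y)).
    by apply/funext => y; rewrite exprSr mulrA.
  by under eq_fun do rewrite exprSr -mulrA.
have -> : (fun y => k y * ((b x - b y) ^+ m.+1 * f y)) =
    (fun y => b x * (k y * ((b x - b y) ^+ m * f y)) +
              (-1) * (k y * ((b x - b y) ^+ m * (b y * f y)))).
  by apply/funext => y; rewrite exprS; ring.
split; first by apply: cintegrableD => //; exact: cintegrableZ.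
rewrite cintegralD ?cintegralZ//; do ?exact: cintegrableZ.
by rewrite -e1 -e2 mulN1r.
Qed.

End iterated_commutator.

(** * The pointwise estimate *)

Section local_estimate.
Context {R : realType} {d : measure_display} {X : measurableType d}.
Variable mu : {measure set X -> \bar R}.
Implicit Types (b f : X -> R[i]) (T : (X -> R[i]) -> X -> R[i]) (F B : set X).

(** Freezing the kernel at the constant [k0] costs a small multiple of the very
    quantity to be estimated, which is absorbed.  The absorption takes place at
    one point: [z] stands for the value of [b] there. *)
Lemma absorb_frozen_kernel F b (k : X -> R[i]) (k0 z : R[i]) (M eps A : R) m
    (fs : nat -> X -> R[i]) :
  measurable F -> (mu F < +oo)%E -> cmeasurable b ->
  (forall y, F y -> normc (b y) <= M) ->
  (forall j, test_function F (fs j)) ->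
  0 <= A -> m.+1%:R * A * eps <= 2^-1 ->
  (forall Q : {poly R[i]}, (size Q <= m.+1)%N ->
    \int[mu]_(y in F) normc Q.[b y] <=
    A * \sum_(j < m.+1) normc (cintegral mu F (fun y => Q.[b y] * fs j y))) ->
  (forall y, F y -> normc (k y - k0) <= eps * normc k0) ->
  (forall j, cintegrable mu F (fun y => k y * ((z - b y) ^+ m * fs j y))) ->
  normc k0 * (\int[mu]_(y in F) normc (z - b y) ^+ m) <=
  2 * A * \sum_(j < m.+1)
    normc (cintegral mu F (fun y => k y * ((z - b y) ^+ m * fs j y))).
Proof.
move=> mF Foo mb bM tfs A0 Aeps norming kk0 ik.
pose Q : {poly R[i]} := (z%:P - 'X) ^+ m.
have QE y : Q.[b y] = (z - b y) ^+ m by rewrite horner_exp !hornerE.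
have sQ : (size Q <= m.+1)%N.
  rewrite (leq_trans (size_poly_exp_leq _ _))// ltnS.
  have : (size (z%:P - 'X)%R <= 2)%N.
    rewrite (leq_trans (size_polyD _ _))// size_polyN size_polyX geq_max andbT.
    by rewrite (leq_trans (size_polyC_leq1 _)).
  by move=> s2; rewrite -[leqRHS]mul1n leq_mul2r -subn1 leq_subLR s2 orbT.
have zb : forall y, F y -> normc ((z - b y) ^+ m) <= (normc z + M) ^+ m.
  move=> y Fy; rewrite normcX lerXn2r ?nnegrE ?normc_ge0//.
    by rewrite addr_ge0 ?normc_ge0// (le_trans _ (bM y Fy))// normc_ge0.
  by rewrite (le_trans (ler_normcB _ _))// lerD2l bM.
have mzb : cmeasurable (fun y => (z - b y) ^+ m).
  by apply/cmeasurableX/cmeasurableB => //; exact: cmeasurable_cst.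
have iz : cintegrable mu F (fun y => (z - b y) ^+ m).
  exact: cintegrable_bounded zb.
have inz : mu.-integrable F (EFin \o (fun y => normc (z - b y) ^+ m)).
  have := integrable_normc mF iz.
  by rewrite /comp; under eq_fun do rewrite normcX.
have izf j : cintegrable mu F (fun y => (z - b y) ^+ m * fs j y).
  apply: (cintegrable_le mF _ inz) => [|y Fy].
    by apply: cmeasurableM => //; case: (tfs j).
  rewrite normcM normcX -[leRHS]mulr1 ler_wpM2l ?exprn_ge0 ?normc_ge0//.
  exact: test_function_le1 (tfs j).
set I := \int[mu]_(y in F) normc (z - b y) ^+ m.
have hI : I <= A * \sum_(j < m.+1)
    normc (cintegral mu F (fun y => (z - b y) ^+ m * fs j y)).
  have := norming Q sQ.
  under eq_Rintegral do rewrite QE normcX.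
  move=> /le_trans; apply; rewrite ler_wpM2l// ler_sum// => j _.
  by under eq_cintegral do rewrite QE.
have I0 : 0 <= I by apply: Rintegral_ge0 => y _; rewrite exprn_ge0 ?normc_ge0.
pose t j := normc (cintegral mu F (fun y => k y * ((z - b y) ^+ m * fs j y))).
have frozen j : normc k0 * normc (cintegral mu F (fun y => (z - b y) ^+ m * fs j y))
    <= t j + eps * normc k0 * I.
  rewrite -normcM -cintegralZ//.
  have ikk0 : cintegrable mu F (fun y => (k y - k0) * ((z - b y) ^+ m * fs j y)).
    have := cintegrableD mF (ik j) (cintegrableZ (- k0) mF (izf j)).
    by under eq_fun do rewrite -mulrDl.
  rewrite (_ : cintegral mu F _ =
      cintegral mu F (fun y => k y * ((z - b y) ^+ m * fs j y)) +
      (-1) * cintegral mu F (fun y => (k y - k0) * ((z - b y) ^+ m * fs j y))).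
    rewrite mulN1r (le_trans (ler_normcB _ _))// lerD2l.
    rewrite -RintegralZl//; apply: normc_cintegral_le => //.
      exact: integrable_scale.
    move=> y Fy; rewrite normcM ler_pM ?normc_ge0 ?kk0//.
    rewrite normcM normcX -[leRHS]mulr1 ler_wpM2l ?exprn_ge0 ?normc_ge0//.
    exact: test_function_le1 (tfs j).
  rewrite -cintegralZ// -cintegralD//; last exact: cintegrableZ.
  by apply: eq_cintegral => y _; ring.
rewrite -/(t _); under eq_bigr do rewrite -/(t _).
set S := \sum_(j < m.+1) t j.
have sum_frozen : normc k0 * I <= A * (S + m.+1%:R * (eps * normc k0 * I)).
  rewrite (le_trans (ler_wpM2l (normc_ge0 _) hI))// mulrCA ler_wpM2l//.
  rewrite mulr_sumr.
  apply: (@le_trans _ _ (\sum_(j < m.+1) (t j + eps * normc k0 * I))).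
    by apply: ler_sum => j _; exact: frozen.
  by rewrite big_split /= sumr_const card_ord mulr_natl.
have Aeps' : m.+1%:R * A * eps * (normc k0 * I) <= 2^-1 * (normc k0 * I).
  by rewrite ler_wpM2r// mulr_ge0 ?normc_ge0.
have e : A * (S + m.+1%:R * (eps * normc k0 * I)) =
  A * S + m.+1%:R * A * eps * (normc k0 * I) by ring.
rewrite e in sum_frozen; lra.
Qed.

Lemma jensen_mean F b (z : R[i]) (v M : R) m : measurable F -> mu F = v%:E ->
  0 < v -> cmeasurable b -> (forall y, F y -> normc (b y) <= M) -> (0 < m)%N ->
  v * normc (z - cavg mu F b) ^+ m <= \int[mu]_(y in F) normc (z - b y) ^+ m.
Proof.
move=> mF Fv v0 mb bM m0.
have Foo : (mu F < +oo)%E by rewrite Fv ltry.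
have ib : cintegrable mu F b by exact: cintegrable_bounded bM.
have mzb : cmeasurable (fun y => z - b y).
  by apply: cmeasurableB => //; exact: cmeasurable_cst.
have zb y : F y -> normc (z - b y) <= normc z + M.
  by move=> Fy; rewrite (le_trans (ler_normcB _ _))// lerD2l bM.
have izb : cintegrable mu F (fun y => z - b y) by exact: cintegrable_bounded zb.
have iz : cintegrable mu F (fun=> z).
  by apply: (@cintegrable_bounded _ _ _ _ _ _ (normc z)).
have inzb := integrable_normc mF izb.
have inm : mu.-integrable F (EFin \o (fun y => normc (z - b y) ^+ m)).
  have /(integrable_normc mF) : cintegrable mu F (fun y => (z - b y) ^+ m).
    apply: (@cintegrable_bounded _ _ _ _ _ _ ((normc z + M) ^+ m)) => //.
      exact: cmeasurableX.
    move=> y Fy; rewrite normcX lerXn2r ?nnegrE ?normc_ge0 ?zb//.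
    by rewrite (le_trans _ (zb y Fy)) ?normc_ge0.
  by rewrite /comp; under eq_fun do rewrite normcX.
set I := \int[mu]_(y in F) normc (z - b y) ^+ m.
have I0 : 0 <= I by apply: Rintegral_ge0 => y _; rewrite exprn_ge0 ?normc_ge0.
have mean : z - cavg mu F b = (v^-1)%:C * cintegral mu F (fun y => z - b y).
  have -> : cintegral mu F (fun y => z - b y) = v%:C * z - cintegral mu F b.
    rewrite -[RHS](_ : cintegral mu F (fun=> z) + (-1) * cintegral mu F b = _).
      rewrite -cintegralZ// -cintegralD//; last exact: cintegrableZ.
      by apply: eq_cintegral => y _; rewrite mulN1r.
    rewrite mulN1r; congr (_ - _); apply: eq_ReIm.
      by rewrite complex_ReM /= Rintegral_cst// Fv /=; ring.
    by rewrite complex_ImM /= Rintegral_cst// Fv /=; ring.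
  rewrite /cavg Fv /= mulrBr mulrA -rmorphM mulVf ?gt_eqF// rmorph1 mul1r.
  by [].
have [|hoo hm] := @jensen_exprn _ _ _ mu F (fun y => normc (z - b y)) m I v
  mF Fv (measurable_normc mzb) (fun y => normc_ge0 _) m0 I0.
  rewrite /I /Rintegral fineK// ge0_fin_numE.
    exact: integrable_lty.
  by apply: integral_ge0 => y _; rewrite lee_fin exprn_ge0 ?normc_ge0.
have le_mean : normc (z - cavg mu F b) <= v^-1 * \int[mu]_(y in F) normc (z - b y).
  rewrite mean normcM normc_real ger0_norm ?invr_ge0 ?(ltW v0)//.
  by rewrite ler_wpM2l ?invr_ge0 ?(ltW v0)//; exact: normc_cintegral_le.
have {}le_mean : normc (z - cavg mu F b) ^+ m <= v ^- m * (I * v ^+ m.-1).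
  rewrite (le_trans (lerXn2r m _ _ le_mean)) ?nnegrE ?normc_ge0//.
    by rewrite mulr_ge0 ?invr_ge0 ?(ltW v0)// Rintegral_ge0// => y _; exact: normc_ge0.
  by rewrite exprMn exprVn ler_wpM2l// invr_ge0 exprn_ge0// ltW.
rewrite (le_trans (ler_wpM2l (ltW v0) le_mean))// le_eqVlt; apply/orP; left.
apply/eqP; case: m m0 {inm hm le_mean} @I I0 => [//|m] _ I I0 /=.
have vn0 : v != 0 by rewrite gt_eqF.
have vm0 : v ^+ m != 0 by rewrite expf_neq0.
rewrite exprS; move: (v ^+ m) vm0 => w w0.
by field; rewrite ?w0 ?vn0.
Qed.

End local_estimate.

(** * Testing the commutator *)

Section testing.
Context {R : realType} {d : measure_display} {X : measurableType d}.
Variables (rho : X -> X -> R) (mu : {measure set X -> \bar R}).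
Implicit Types (b f g : X -> R[i]) (F B : set X).

Lemma commutator_dom_test_function m F b f (M : R) : measurable F ->
  (mu F < +oo)%E -> cmeasurable b -> (forall y, F y -> normc (b y) <= M) ->
  test_function F f -> commutator_dom mu m b f.
Proof.
move=> mF Foo mb bM tf j _; have mf := tf.1.
have mbf : cmeasurable (fun x => b x ^+ j * f x).
  by apply: cmeasurableM => //; exact: cmeasurableX.
split => //; have Mj0 : 0 <= `|M| ^+ j by exact: exprn_ge0.
have bfM y : normc (b y ^+ j * f y) <= `|M| ^+ j * \1_F y.
  have [Fy|nFy] := pselect (F y); last first.
    rewrite (test_function_off tf nFy) mulr0 normc0.
    by rewrite indicE memNset// mulr0.
  rewrite indicE mem_set// mulr1 normcM normcX -[leRHS]mulr1.
  rewrite ler_pM ?exprn_ge0 ?normc_ge0// ?(test_function_le1 y tf)//.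
  rewrite lerXn2r ?nnegrE ?normc_ge0//.
  by rewrite (le_trans (bM y Fy))// ler_norm.
apply: le_lt_trans (wnorm_le (w := cst 1) mu _ mF _ _ mbf Mj0 bfM) _ => //.
apply: poweR_lty; rewrite -[X in (_ * X)%E]/(\int[mu]_(x in F) (cst 1%:E) x)%E.
have Ffin : mu F \is a fin_num by rewrite ge0_fin_numE.
by rewrite integral_cst// mul1e -(fineK Ffin) -EFinM ltry.
Qed.

(** Hölder's inequality for
    [normc g = (normc g `^ p * l) `^ p^-1 * (dual_weight p l) `^ (1 - p^-1)]. *)
Lemma integral_normc_le_wnorm (p Y L' : R) (l : X -> R) B g : 1 < p ->
  measurable B -> cmeasurable g -> measurable_fun setT l ->
  (forall x, 0 <= l x) -> {ae mu, forall x, 0 < l x} -> 0 <= Y -> 0 <= L' ->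
  (wnorm mu p l g <= Y%:E)%E ->
  (\int[mu]_(x in B) (dual_weight p l x)%:E <= L'%:E)%E ->
  (\int[mu]_(x in B) (normc (g x))%:E <= (Y * L' `^ (1 - p^-1))%:E)%E.
Proof.
move=> p1 mB mg ml l0 lpos Y0 L'0 gY hL'.
have p0 : 0 < p by rewrite (lt_trans ltr01).
have mgp : measurable_fun setT (fun x => normc (g x) `^ p * l x).
  by apply: measurable_funM => //; exact/measurable_fun_powR/measurable_normc.
have gp0 x : 0 <= normc (g x) `^ p * l x by rewrite mulr_ge0 ?powR_ge0.
have int0 : (0 <= \int[mu]_x (normc (g x) `^ p * l x)%:E)%E.
  by apply: integral_ge0 => x _; rewrite lee_fin.
have gYp : (\int[mu]_(x in B) (normc (g x) `^ p * l x)%:E <= (Y `^ p)%:E)%E.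
  apply: (@le_trans _ _ (\int[mu]_x (normc (g x) `^ p * l x)%:E)%E).
    apply: ge0_subset_integral => //; first exact/measurable_EFinP.
    by move=> x _; rewrite lee_fin.
  rewrite -(poweRe1 int0) -(mulVf (lt0r_neq0 p0)) poweRrM -poweR_EFin.
  apply: gt0_ler_poweR gY; first exact: ltW.
    by rewrite in_itv /= leey andbT poweR_ge0.
  by rewrite in_itv /= leey andbT lee_fin.
have -> : Y = (Y `^ p) `^ p^-1 by rewrite -powRrM mulfV ?gt_eqF// powRr1.
apply: (hoelder_le (f := fun x => normc (g x) `^ p * l x)
  (g := dual_weight p l)) hL' _ => //.
- exact: measurable_fun_powR.
- exact: measurable_normc.
- by move=> x; exact: powR_ge0.
- by move=> x; exact: normc_ge0.
- by rewrite invr_gt0.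
- by rewrite invf_le1// ltW.
- exact: powR_ge0.
apply: filterS lpos => x lx _; rewrite dual_weight_powR//.
rewrite powRM ?powR_ge0 ?normc_ge0// -powRrM mulfV ?gt_eqF//.
rewrite powRr1 ?normc_ge0// -mulrA -powRD; last first.
  by apply/implyP => _; rewrite gt_eqF.
by rewrite subrr powRr0 mulr1.
Qed.

Variables (T : (X -> R[i]) -> X -> R[i]) (K : X -> X -> R[i]).
Hypotheses (T_L2 : L2_bounded_linear mu T) (T_kernel : has_kernel rho mu T K).

(** At almost every point of [B] the kernel formula holds for the finitely many
    functions [b ^+ i * fs j], and [absorb_frozen_kernel] bounds the oscillation
    by the values of the commutator there; integrating over [B] brings in the
    assumed bound [N]. *)
Lemma oscillation_le_commutator m (p N L L' eps v M : R) (l1 l2 : X -> R) B F b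
    (k0 : R[i]) : (0 < m)%N -> 1 < p ->
  measurable B -> measurable F -> mu F = v%:E -> 0 < v ->
  cmeasurable b -> (forall y, F y -> normc (b y) <= M) ->
  (forall x, B x -> exists2 s, 0 < s & forall y, F y -> s <= rho x y) ->
  0 < normc k0 -> m.+1%:R * 3 ^+ m.+1 * eps <= 2^-1 ->
  (forall x y, B x -> F y -> normc (K x y - k0) <= eps * normc k0) ->
  Ap rho mu p l1 -> Ap rho mu p l2 -> 0 <= L -> 0 <= L' ->
  (\int[mu]_(x in F) (l1 x)%:E <= L%:E)%E ->
  (\int[mu]_(x in B) (dual_weight p l2 x)%:E <= L'%:E)%E ->
  0 <= N ->
  (forall f, commutator_dom mu m b f -> in_Lpw mu p l1 f ->
    (wnorm mu p l2 (iter_commutator m b T f) <= N%:E * wnorm mu p l1 f)%E) ->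
  (\int[mu]_(x in B) (normc (b x - cavg mu F b) ^+ m)%:E <=
   (2 * 3 ^+ m.+1 * m.+1%:R / (v * normc k0) *
     (N * (L `^ p^-1 * L' `^ (1 - p^-1))))%:E)%E.
Proof.
move=> m0 p1 mB mF Fv v0 mb bM sep k00 eps_le KK0 l1A l2A L0 L'0 hL hL' N0 Nb.
have p0 : 0 < p by rewrite (lt_trans ltr01).
have Foo : (mu F < +oo)%E by rewrite Fv ltry.
have [fs tfs norming] := norming_test_functions m.+1 mF Foo mb bM.
pose T_ j := iter_commutator m b T (fs j).
have dom j : commutator_dom mu m b (fs j).
  exact: commutator_dom_test_function bM (tfs j).
have mT j : cmeasurable (T_ j).
  apply: cmeasurable_iter_commutator => // g gL2.
  by case: T_L2 => _ [C /(_ g gL2)[]].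
have [[ml1 l10 _ _] _] := l1A.
have [[ml2 l20 l2pos _] _] := l2A.
have T_le j : (\int[mu]_(x in B) (normc (T_ j x))%:E <=
    (N * (L `^ p^-1 * L' `^ (1 - p^-1)))%:E)%E.
  rewrite mulrA; apply: (integral_normc_le_wnorm p1 mB (mT j) ml2) hL' => //.
    by rewrite mulr_ge0 ?powR_ge0.
  have f1 : (wnorm mu p l1 (fs j) <= (L `^ p^-1)%:E)%E.
    have f1 y : normc (fs j y) <= 1 * \1_F y by rewrite mul1r; exact: (tfs j).2.
    have := wnorm_le mu p0 mF ml1 l10 (tfs j).1 ler01 f1.
    move=> /le_trans; apply.
    rewrite powR1 mul1e -poweR_EFin; apply: gt0_ler_poweR hL.
    - by rewrite invr_ge0 ltW.
    - rewrite in_itv /= leey andbT integral_ge0// => y _; by rewrite lee_fin.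
    - by rewrite in_itv /= leey andbT lee_fin.
  have fL : in_Lpw mu p l1 (fs j).
    by split; [exact: (tfs j).1|exact: le_lt_trans f1 (ltry _)].
  rewrite (le_trans (Nb _ (dom j) fL))// EFinM.
  by rewrite lee_wpmul2l// lee_fin.
have kernel_ae : {ae mu, forall x, B x -> forall j i, (i <= m)%N ->
    cintegrable mu setT (fun y => K x y * (b y ^+ i * fs j y)) /\
    T (fun y => b y ^+ i * fs j y) x =
      cintegral mu setT (fun y => K x y * (b y ^+ i * fs j y))}.
  have : {ae mu, forall x, forall j i, (i <= m)%N -> B x ->
      cintegrable mu setT (fun y => K x y * (b y ^+ i * fs j y)) /\
      T (fun y => b y ^+ i * fs j y) x =
        cintegral mu setT (fun y => K x y * (b y ^+ i * fs j y))}.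
    apply: ae_foralln => j; apply: ae_foralln => i.
    have [im|mi] := leqP i m; last by apply/aeW => x; rewrite ?leqNgt ?mi.
    apply: filterS (T_kernel (dom j i im)) => x Tx _ Bx; apply: Tx => sx.
    have [s s0 hs] := sep x Bx.
    have [y [xy /= by0]] := sx s s0.
    have Fy : F y.
      apply: contrapT => nFy; move: by0.
      by rewrite (test_function_off (tfs j) nFy) mulr0 eqxx.
    by have := hs y Fy; rewrite leNgt => /negP; apply; exact: xy.
  by apply: filterS => x h Bx j i im; exact: h.
have pointwise : {ae mu, forall x, B x ->
    normc (b x - cavg mu F b) ^+ m <=
    2 * 3 ^+ m.+1 / (v * normc k0) * \sum_(j < m.+1) normc (T_ j x)}.
  apply: filterS kernel_ae => x kx Bx.
  have {}kx j := iter_commutator_kernel (kx Bx j).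
  have off j y : ~ F y -> K x y * ((b x - b y) ^+ m * fs j y) = 0.
    by move=> nFy; rewrite (test_function_off (tfs j) nFy) !mulr0.
  have := absorb_frozen_kernel mF Foo mb bM tfs (exprn_ge0 m.+1 _) eps_le norming
    (k := K x) (z := b x) (fun y Fy => KK0 x y Bx Fy)
    (fun j => cintegrable_supp mF (kx j).1).
  have t3 : 0 <= 3 :> R by [].
  move=> /(_ t3).
  under eq_bigr => j _ do rewrite -(cintegral_supp mu mF (off j)) -(kx j).2.
  have := jensen_mean (b x) mF Fv v0 mb bM m0.
  set I := \int[mu]_(y in F) _; set S := \sum_(j < m.+1) _ => hI hS.
  have vk0 : 0 < v * normc k0 by rewrite mulr_gt0.
  rewrite mulrAC ler_pdivlMr//; apply: le_trans hS.
  by rewrite mulrA mulrC (mulrC _ v) ler_wpM2l// ltW.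
have c0 : 0 <= 2 * 3 ^+ m.+1 / (v * normc k0).
  by rewrite divr_ge0 ?mulr_ge0 ?exprn_ge0 ?(ltW v0) ?normc_ge0.
have mS : measurable_fun setT (fun x => \sum_(j < m.+1) normc (T_ j x)).
  by apply: measurable_sum => j; exact: measurable_normc.
apply: (@le_trans _ _ (\int[mu]_(x in B)
    (2 * 3 ^+ m.+1 / (v * normc k0) * \sum_(j < m.+1) normc (T_ j x))%:E)%E).
  apply: ae_ge0_le_integral => //.
  - by move=> x _; rewrite lee_fin exprn_ge0 ?normc_ge0.
  - apply/measurable_EFinP/measurable_funTS/measurable_funX/measurable_normc.
    by apply: cmeasurableB => //; exact: cmeasurable_cst.
  - move=> x _; rewrite lee_fin mulr_ge0// sumr_ge0// => j _; exact: normc_ge0.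
  - by apply/measurable_EFinP/measurable_funTS/measurable_funM.
under eq_integral do rewrite EFinM.
rewrite ge0_integralZl//; last 2 first.
- by apply/measurable_EFinP; exact: measurable_funTS.
- by move=> x _; rewrite lee_fin sumr_ge0// => j _; exact: normc_ge0.
rewrite (mulrAC _ m.+1%:R) -(mulrA _ m.+1%:R) [leRHS]EFinM lee_wpmul2l ?lee_fin//.
under eq_integral do rewrite -sumEFin.
rewrite ge0_integral_sum//; last 2 first.
- move=> j; apply/measurable_EFinP/measurable_funTS; exact: measurable_normc.
- by move=> j x _; rewrite lee_fin normc_ge0.
apply: (@le_trans _ _ (\sum_(j < m.+1) (N * (L `^ p^-1 * L' `^ (1 - p^-1)))%:E)%E).
  by apply: lee_sum => j _; exact: T_le.
by rewrite sumEFin sumr_const card_ord mulr_natl.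
Qed.

End testing.

(** * Freezing the kernel *)

Section frozen_kernel.
Context {R : realType} {d : measure_display} {X : measurableType d}.
Variables (rho : X -> X -> R) (A0 : R) (mu : {measure set X -> \bar R}).
Hypothesis hX : homogeneous_type rho A0 mu.

Local Notation ball := (qball rho).
Local Notation vol := (vball rho mu).

Lemma modulus_small (omega : R -> R) (e : R) : modulus_of_continuity omega ->
  omega t @[t --> 0^'+] --> 0 -> 0 < e ->
  exists2 delta : R, 0 < delta & forall t, 0 <= t -> t < delta -> omega t <= e.
Proof.
move=> [_ _ _ _ om0] om_cvg e0.
have /cvgrPdist_lt /(_ e e0) [delta /= delta0 hdelta] := om_cvg.
exists delta => // t; rewrite le_eqVlt => /predU1P[<- _|t0 td].
  by rewrite om0 ltW.
have /= := hdelta t; rewrite !sub0r !normrN gtr0_norm// => /(_ td t0) om_lt.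
by rewrite (le_trans (ler_norm _))// ltW.
Qed.

(** When two balls of radius [r] are [lam * r] apart, the variation of the kernel
    on their product is at most [omega (2 * A0 / lam)] times the reciprocal of the
    volume at scale [lam * r], up to a constant, while non-degeneracy bounds [k0]
    below by that same reciprocal up to a constant.  Neither constant depends on
    [lam], which can therefore be chosen after [eps]. *)
Lemma frozen_kernel T K omega (eps : R) : calderon_zygmund rho A0 mu T K omega ->
  omega t @[t --> 0^'+] --> 0 -> nondegenerate_kernel rho mu K -> 0 < eps ->
  exists S c : R, [/\ 0 < S, 0 < c & forall x0 r, 0 < r ->
    exists y0 (k0 : R[i]), [/\ rho x0 y0 <= S * r, 0 < normc k0,
      (normc k0)^-1 <= c * vol x0 r &
      forall x y, ball x0 r x -> ball y0 r y ->
        r <= rho x y /\ normc (K x y - k0) <= eps * normc k0]].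
Proof.
move=> [_ _ hom [C C0 [_ hreg]]] om_cvg [c0 [Cb [c00 Cb0 hK]]] eps0.
have A01 := A0_ge1 hX; have A00 : 0 < A0 by rewrite (lt_le_trans _ A01).
have [D1 D11 hD1] := vball_doubling hX (2 * A0).
have [D2 D21 hD2] := vball_comparable hX Cb 1.
have D10 : 0 < D1 by rewrite (lt_le_trans _ D11).
have D20 : 0 < D2 by rewrite (lt_le_trans _ D21).
pose e := eps / (C * c0 * (D1 + D2)).
have e0 : 0 < e by rewrite divr_gt0// !mulr_gt0// addr_gt0.
have [delta delta0 hdelta] := modulus_small hom om_cvg e0.
(* The first term separates the balls enough for the regularity condition to
   apply, the second makes [2 * A0 / lam], which bounds the arguments of [omega],
   smaller than [delta]. *)
pose lam := 4 * A0 ^+ 2 + 4 * A0 / delta.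
have lam0 : 0 < lam by rewrite addr_gt0 ?mulr_gt0 ?invr_gt0 ?exprn_gt0.
have lamA : 4 * A0 ^+ 2 <= lam by rewrite lerDl !mulr_ge0 ?invr_ge0 ?ltW.
have lam2A : 2 * A0 <= lam.
  apply: le_trans lamA; rewrite expr2; nra.
have lamd : 2 * A0 / lam < delta.
  rewrite ltr_pdivrMr// /lam mulrDr [X in _ + X](_ : _ = 4 * A0).
    rewrite ltr_wpDl ?mulr_ge0 ?exprn_ge0 ?(ltW A00) ?(ltW delta0)//.
    by rewrite ltr_pM2r// ltr_nat.
  by field; rewrite gt_eqF.
have [D3 D31 hD3] := vball_doubling hX lam.
have D30 : 0 < D3 by rewrite (lt_le_trans _ D31).
exists (Cb * lam), (c0 * D3); split; rewrite ?mulr_gt0// => x0 r r0.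
have lr0 : 0 < lam * r by rewrite mulr_gt0.
have [y0 [[y0in y0out] hk0]] := hK x0 (lam * r) lr0.
have {y0in} up : rho x0 y0 < Cb * (lam * r) by exact: y0in.
have {y0out} lo : lam * r <= rho x0 y0 by rewrite leNgt; apply/negP; exact: y0out.
have v0 := vball_gt0 hX x0 lr0.
have k00 : 0 < normc (K x0 y0).
  by apply: lt_le_trans hk0; rewrite invr_gt0 mulr_gt0.
have k0V : (normc (K x0 y0))^-1 <= c0 * vol x0 (lam * r).
  by rewrite -[leRHS]invrK lef_pV2// posrE ?invr_gt0 ?mulr_gt0.
exists y0, (K x0 y0); split => //.
- by rewrite -mulrA ltW.
- by rewrite (le_trans k0V)// -mulrA ler_wpM2l ?hD3// ltW.
move=> x y xr yr; have {}xr : rho x0 x < r by exact: xr.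
have {}yr : rho y0 y < r by exact: yr.
have far : lam * r / (2 * A0) <= rho x0 y.
  have tri := rho_triangle hX x0 y0 y.
  have tri' : lam * r <= A0 * (rho x0 y + r).
    by rewrite (le_trans lo)// (le_trans tri)// ler_pM2l// lerD2l (rhoC hX y) ltW.
  have : A0 * r <= lam * r / 2.
    by rewrite ler_pdivlMr// mulrAC ler_wpM2r ?(ltW r0)// mulrC.
  rewrite ler_pdivrMr ?mulr_gt0//; lra.
have far' : 2 * A0 * r <= rho x0 y.
  apply: le_trans far; rewrite ler_pdivlMr ?mulr_gt0// mulrAC ler_wpM2r ?(ltW r0)//.
  by apply: le_trans lamA; rewrite expr2; lra.
have xy0 : 0 < rho x0 y by apply: lt_le_trans far'; rewrite !mulr_gt0.
have x0y0 : 0 < rho x0 y0 by apply: lt_le_trans lo.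
split.
  have tri := rho_triangle hX x0 y x.
  have : 2 * A0 * r <= A0 * (r + rho x y).
    by rewrite (le_trans far')// (le_trans tri)// ler_pM2l// lerD2r ltW.
  by rewrite mulrAC (mulrC _ A0) ler_pM2l//; lra.
have neq z w : 0 < rho z w -> z <> w.
  by move=> + zw; rewrite zw (rhoxx hX) ltxx.
have half : r <= (2 * A0)^-1 * rho x0 y by rewrite mulrC ler_pdivlMr ?mulr_gt0// mulrC.
have half' : r <= (2 * A0)^-1 * rho y0 x0.
  rewrite mulrC ler_pdivlMr ?mulr_gt0// (rhoC hX) mulrC (le_trans _ lo)//.
  by rewrite ler_wpM2r// ltW.
have small (t s : R) : 0 <= t -> t < r -> lam * r / (2 * A0) <= s ->
    omega (t / s) <= e.
  move=> t0 tr ls.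
  have s0 : 0 < s by apply: lt_le_trans ls; rewrite divr_gt0 ?mulr_gt0.
  apply: hdelta; first by rewrite divr_ge0// ltW.
  apply: le_lt_trans lamd; rewrite ler_pdivrMr// mulrAC ler_pdivlMr//.
  rewrite mulrC -ler_pdivrMl ?mulr_gt0// (le_trans _ ls)//.
  rewrite [leRHS]mulrC ler_wpM2l ?invr_ge0 ?mulr_ge0 ?(ltW A00)//.
  by rewrite ler_wpM2l// ltW.
have V1 : vol x0 (lam * r) <= D1 * V rho mu x0 y.
  have -> : lam * r = 2 * A0 * (lam * r / (2 * A0)).
    by field; rewrite gt_eqF.
  rewrite (le_trans (hD1 _ _ _)) ?divr_gt0 ?mulr_gt0// ler_wpM2l ?(ltW D10)//.
  by apply: (ler_vball hX) => //; exact: subset_qball.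
have V2 : vol x0 (lam * r) <= D2 * V rho mu y0 x0.
  rewrite -[X in vol _ X]mul1r (le_trans (hD2 y0 _ _ lr0 _))//.
    by rewrite (rhoC hX) ltW.
  rewrite ler_wpM2l ?(ltW D20)//; apply: (ler_vball hX).
    by rewrite (rhoC hX).
  by apply: subset_qball; rewrite (rhoC hX).
have step (D W om : R) : 0 < D -> 0 < W -> vol x0 (lam * r) <= D * W ->
    om <= e -> C / W * om <= C * c0 * D * e * normc (K x0 y0).
  move=> D0 W0 vDW ome.
  have WV : W^-1 <= D * c0 * normc (K x0 y0).
    have : D * W / vol x0 (lam * r) >= 1 by rewrite ler_pdivlMr ?mul1r.
    have : (vol x0 (lam * r))^-1 <= c0 * normc (K x0 y0).
      by rewrite -ler_pdivrMl// -invfM.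
    move=> k1 k2; rewrite -[leLHS]mul1r ler_pdivrMr//.
    apply: (le_trans k2); rewrite -!mulrA ler_wpM2l ?(ltW D0)//.
    by rewrite mulrC mulrA ler_wpM2r// ltW.
  apply: (@le_trans _ _ (C * (D * c0 * normc (K x0 y0)) * e)).
    apply: (@le_trans _ _ (C / W * e)).
      by rewrite ler_wpM2l// divr_ge0// ltW.
    by rewrite ler_wpM2r ?(ltW e0)// ler_wpM2l// ltW.
  by rewrite le_eqVlt; apply/orP; left; apply/eqP; ring.
have r1 := hreg x0 x y (neq _ _ xy0) (le_trans (ltW xr) half).
have y0x0 : 0 < rho y0 x0 by rewrite (rhoC hX).
have r2 := hreg y0 y x0 (neq _ _ y0x0) (le_trans (ltW yr) half').
have b1 := step D1 _ _ D10 (vball_gt0 hX x0 xy0) V1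
  (small _ _ (rho_ge0 hX x0 x) xr far).
have b2 := step D2 _ _ D20 (vball_gt0 hX y0 y0x0) V2
  (small (rho y0 y) (rho y0 x0) (rho_ge0 hX y0 y) yr _).
have {}b2 : C / V rho mu y0 x0 * omega (rho y0 y / rho y0 x0) <=
    C * c0 * D2 * e * normc (K x0 y0).
  apply: b2; rewrite (rhoC hX) (le_trans _ lo)// ler_pdivrMr ?mulr_gt0//.
  by rewrite ler_peMr ?(ltW lr0)//; lra.
have e1 : normc (K x0 y - K x y) <= C * c0 * D1 * e * normc (K x0 y0).
  rewrite (le_trans _ b1)// (le_trans _ r1)//.
  by rewrite lerDl normc_ge0.
have e2 : normc (K x0 y0 - K x0 y) <= C * c0 * D2 * e * normc (K x0 y0).
  rewrite (le_trans _ b2)// (le_trans _ r2)//.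
  by rewrite lerDr normc_ge0.
have -> : K x y - K x0 y0 = - ((K x0 y - K x y) + (K x0 y0 - K x0 y)).
  by rewrite opprD !opprB addrACA; ring.
rewrite normcN (le_trans (ler_normcD _ _))// (le_trans (lerD e1 e2))//.
rewrite -mulrDl ler_wpM2r ?normc_ge0// -mulrDl -mulrDr.
by rewrite /e mulrC divfK// gt_eqF// !mulr_gt0// addr_gt0.
Qed.

End frozen_kernel.

(** * Mean oscillation *)

Section oscillation.
Context {R : realType} {d : measure_display} {X : measurableType d}.
Variable mu : {measure set X -> \bar R}.
Implicit Types (b : X -> R[i]) (B F : set X).

(** Restricting to a sublevel set puts all the functions [b ^+ j * f] in [L^2],
    although [b] is only locally integrable. *)
Lemma large_sublevel B b (v : R) : measurable B -> mu B = v%:E -> 0 < v ->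
  cmeasurable b -> exists n : nat,
    measurable (B `&` [set x | normc (b x) <= n%:R]) /\
    ((v / 2)%:E <= mu (B `&` [set x | (normc (b x) <= n%:R)%R]))%E.
Proof.
move=> mB Bv v0 mb; pose F n := B `&` [set x | normc (b x) <= n%:R].
have mF n : measurable (F n).
  apply: measurableI => //.
  have := measurable_normc mb measurableT (measurable_itv `]-oo, n%:R]).
  rewrite setTI.
  by congr (measurable _); apply/seteqP; split => x /=; rewrite in_itv.
have FB : \bigcup_n F n = B.
  apply/seteqP; split => [x [n _ []]//|x Bx].
  exists (Num.trunc (normc (b x))).+1 => //; split => //=.
  by rewrite ltW// truncnS_gt.
have ndF : nondecreasing_seq F.
  move=> n k nk; apply/subsetPset => x [Bx /= bn]; split => //=.
  by rewrite (le_trans bn)// ler_nat.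
have cvgF : mu (F n) @[n --> \oo] --> v%:E.
  rewrite -Bv -FB; apply: nondecreasing_cvg_mu => //.
  by apply: bigcup_measurable => n _.
apply: contrapT => /forallNP small.
have Flt n : (mu (F n) <= (v / 2)%:E)%E.
  by rewrite leNgt; apply/negP => h; apply: (small n); split; [exact: mF|exact: ltW].
have : (v%:E <= (v / 2)%:E)%E.
  rewrite -(cvg_lim _ cvgF)//; apply: lime_le; first by apply/cvg_ex; exists v%:E.
  by apply: nearW => n.
by rewrite lee_fin ler_pdivlMr// ger_pMr// leNgt ltr1n.
Qed.

(** The mean of [b] differs from any [c] by at most the mean of [normc (b - c)]. *)
Lemma mean_oscillation_le B b (c : R[i]) (v : R) : measurable B -> mu B = v%:E ->
  0 < v -> cmeasurable b -> cintegrable mu B b ->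
  (\int[mu]_(x in B) (normc (b x - cavg mu B b))%:E <=
   (2 * \int[mu]_(x in B) normc (b x - c))%:E)%E.
Proof.
move=> mB Bv v0 mb ib.
have icst (z : R[i]) : cintegrable mu B (fun=> z).
  by apply: (@cintegrable_bounded _ _ _ _ _ _ (normc z)); rewrite // Bv ltry.
have idiff (z : R[i]) : cintegrable mu B (fun x => b x - z).
  by have := cintegrableD mB ib (icst (- z)).
have inorm (z : R[i]) := integrable_normc mB (idiff z).
have mean : c - cavg mu B b = - ((v^-1)%:C * cintegral mu B (fun x => b x - c)).
  have -> : cintegral mu B (fun x => b x - c) = cintegral mu B b - v%:C * c.
    rewrite (cintegralD mB ib (icst (- c))); congr (_ + _).
    apply: eq_ReIm.
      by rewrite /= Rintegral_cst// Bv; case: c => c1 c2 /=; ring.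
    by rewrite /= Rintegral_cst// Bv; case: c => c1 c2 /=; ring.
  rewrite /cavg Bv /= mulrBr mulrA -rmorphM mulVf ?gt_eqF// rmorph1 mul1r.
  by rewrite opprB.
have mean_le : v * normc (c - cavg mu B b) <= \int[mu]_(x in B) normc (b x - c).
  rewrite mean normcN normcM normc_real ger0_norm ?invr_ge0 ?(ltW v0)//.
  rewrite mulrA mulfV ?gt_eqF// mul1r.
  exact: normc_cintegral_le (idiff c) (inorm c) _.
have -> : (\int[mu]_(x in B) (normc (b x - cavg mu B b))%:E =
    (\int[mu]_(x in B) normc (b x - cavg mu B b))%:E)%E.
  rewrite /Rintegral fineK// ge0_fin_numE ?integrable_lty//.
  by apply: integral_ge0 => x _; rewrite lee_fin normc_ge0.
rewrite lee_fin.
apply: (@le_trans _ _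
  (\int[mu]_(x in B) (normc (b x - c) + normc (c - cavg mu B b)))).
  apply: le_Rintegral => //; first exact: inorm.
    rewrite /comp; under eq_fun do rewrite EFinD.
    apply: integrableD => //.
    by have := integrable_normc mB (icst (c - cavg mu B b)).
  by move=> x _; rewrite -[X in normc X](subrKA c) ler_normcD.
have icm : mu.-integrable B (EFin \o cst (normc (c - cavg mu B b))).
  by have := integrable_normc mB (icst (c - cavg mu B b)).
rewrite (RintegralD mB (inorm c) icm) mulrDl mul1r lerD2l.
by rewrite Rintegral_cst// Bv mulrC.
Qed.

End oscillation.

(** * The estimate of the oscillation *)

Section bloom_bmo.
Context {R : realType} {d : measure_display} {X : measurableType d}.
Variables (rho : X -> X -> R) (A0 : R) (mu : {measure set X -> \bar R}).
Hypothesis hX : homogeneous_type rho A0 mu.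
Variables (p : R) (l1 l2 : X -> R).
Hypotheses (p1 : 1 < p) (l1A : Ap rho mu p l1) (l2A : Ap rho mu p l2).
Variables (T : (X -> R[i]) -> X -> R[i]) (K : X -> X -> R[i]) (omega : R -> R).
Hypotheses (hT : calderon_zygmund rho A0 mu T K omega)
  (omega0 : omega t @[t --> 0^'+] --> 0) (hK : nondegenerate_kernel rho mu K).
Variable m : nat.
Hypothesis m_gt0 : (0 < m)%N.

Local Notation ball := (qball rho).
Local Notation vol := (vball rho mu).

Lemma subset_integral_le (w : X -> R) B D (L : R) : measurable B -> measurable D ->
  B `<=` D -> measurable_fun setT w -> (forall x, 0 <= w x) ->
  (\int[mu]_(x in D) (w x)%:E = L%:E)%E ->
  (\int[mu]_(x in B) (w x)%:E <= L%:E)%E.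
Proof.
move=> mB mD BD mw w0 <-; apply: ge0_subset_integral => //.
  by apply/measurable_EFinP; exact: measurable_funTS.
by move=> x _; rewrite lee_fin.
Qed.

(** [bloom_ball] is used on a ball containing [B] and the second ball, and
    [vball_le_bloom_root] on [B] itself; the integrals of the inverse weight that
    link the two only grow with the ball.  What remains are volumes of comparable
    balls, and these cancel. *)
Lemma oscillation_le : exists2 C : R, 0 < C &
  forall (b : X -> R[i]) N, L1loc rho mu b -> 0 <= N ->
  (forall f, commutator_dom mu m b f -> in_Lpw mu p l1 f ->
    (wnorm mu p l2 (iter_commutator m b T f) <= N%:E * wnorm mu p l1 f)%E) ->
  forall x r, 0 < r -> exists osc W : R, [/\ 0 <= osc, 0 < W,
    (\int[mu]_(y in ball x r)
       (normc (b y - cavg mu (ball x r) b))%:E <= osc%:E)%E,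
    (\int[mu]_(y in ball x r) (bloom_root p l1 l2 m y)%:E = W%:E)%E &
    osc ^+ m <= C * N * W ^+ m].
Proof.
have A01 := A0_ge1 hX; have A00 : 0 < A0 by rewrite (lt_le_trans _ A01).
have [G GE] : exists G : R, G = 2 * 3 ^+ m.+1 * m.+1%:R by eexists.
have G0 : 0 < G by rewrite GE !mulr_gt0 ?exprn_gt0.
pose eps : R := G^-1.
have eps0 : 0 < eps by rewrite invr_gt0.
have eps_le : m.+1%:R * 3 ^+ m.+1 * eps <= 2^-1.
  rewrite /eps GE le_eqVlt; apply/orP; left; apply/eqP.
  have : 3 ^+ m.+1 != 0 :> R by rewrite expf_neq0// pnatr_eq0.
  move: (3 ^+ m.+1) => t t0; field.
  by rewrite t0 addrC natr1 pnatr_eq0.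
have [S [c [S0 c0 hfrozen]]] := frozen_kernel hX hT omega0 hK eps0.
pose tau := A0 * (S + 1).
have tau1 : 1 <= tau by rewrite -[leLHS]mul1r ler_pM// lerDr ltW.
have tau0 : 0 < tau by rewrite (lt_le_trans _ tau1).
have [D1 D11 hD1] := vball_doubling hX tau.
have [D2 D21 hD2] := vball_comparable hX S tau.
have D10 : 0 < D1 by rewrite (lt_le_trans _ D11).
have D20 : 0 < D2 by rewrite (lt_le_trans _ D21).
have [A A_gt0 hA] := bloom_ball hX p1 l1A l2A.
exists (2 ^+ m * (2 * (G * A * c * D1 * D2))) => [|b N bloc N0 Nb x r r0].
  by rewrite !mulr_gt0 ?exprn_gt0.
have [y0 [k0 [y0S k00 k0V near]]] := hfrozen x r r0.
have mb := bloc.1.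
have tr0 : 0 < tau * r by rewrite mulr_gt0.
set B := ball x r; set B' := ball x (tau * r); set B2 := ball y0 r.
have mB : measurable B := measurable_qball hX x r.
have mB' : measurable B' := measurable_qball hX x (tau * r).
have mB2 : measurable B2 := measurable_qball hX y0 r.
have BB' : B `<=` B' by apply: subset_qball; rewrite ler_peMl// ltW.
have B2B' : B2 `<=` B'.
  move=> z y0z; have {}y0z : rho y0 z < r by exact: y0z.
  rewrite /B' /qball /= (le_lt_trans (rho_triangle hX x z y0))//.
  by rewrite /tau -mulrA ltr_pM2l// mulrDl mul1r ler_ltD.
have v0 := vball_gt0 hX x r0; have v'0 := vball_gt0 hX x tr0.
have v20 := vball_gt0 hX y0 r0.
have [n [mF Fhalf]] := large_sublevel mB2 (mu_qball hX y0 r0) v20 mb.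
set F := _ `&` _ in mF Fhalf.
have FB2 : F `<=` B2 by move=> z [].
have Foo : (mu F < +oo)%E.
  apply: le_lt_trans (mu_qball_lty hX y0 r0).
  by rewrite le_measure ?inE.
have Fv : mu F = (fine (mu F))%:E by rewrite fineK// ge0_fin_numE.
set vF := fine (mu F) in Fv.
have vF_ge : vol y0 r / 2 <= vF by rewrite -lee_fin -Fv.
clearbody vF.
have vF0 : 0 < vF by apply: lt_le_trans vF_ge; rewrite divr_gt0.
have [L [L' [J [[L0 L'0] J0 [iL iL'] [iJ _] hLJ]]]] := hA x (tau * r) tr0.
have [L_ [L'_ [J1 [_ J10 _ [iJ1 _] _]]]] := hA x r r0.
have [[ml1 l10 _ _] _] := l1A; have [[ml2 l20 _ _] _] := l2A.
have mnu := measurable_bloom_weight l1A l2A.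
have nu0 := bloom_weight_ge0 p l1 l2.
have [_ _ _ hroot] := weight_bloom_root hX p1 l1A l2A m_gt0.
have [W W0 iW] := ge0_integral_real (fun y => powR_ge0 _ _) (hroot x r r0).
have vW : vol x r ^+ m.+1 <= W ^+ m * J.
  apply: le_trans (vball_le_bloom_root hX l1A l2A m_gt0 r0 J10 W0 iJ1 iW) _.
  rewrite ler_wpM2l ?exprn_ge0// -lee_fin -iJ1.
  apply: subset_integral_le mB mB' BB' _ _ iJ.
    have -> : (fun y => (bloom_weight p l1 l2 y)^-1) =
              (fun y => bloom_weight p l1 l2 y `^ (-1)).
      by apply/funext => y; rewrite powR_inv1// nu0.
    exact: measurable_fun_powR.
  by move=> y; rewrite invr_ge0.
have Wpos : 0 < W.
  rewrite lt_neqAle W0 andbT eq_sym; apply/eqP => W00.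
  by move: vW; rewrite W00 expr0n gtn_eqF// mul0r leNgt exprn_gt0.
set LL := L `^ p^-1 * L' `^ (1 - p^-1) in hLJ.
have LL0 : 0 <= LL by rewrite mulr_ge0 ?powR_ge0.
pose cF := cavg mu F b.
have osc_m : (\int[mu]_(y in B) (normc (b y - cF) ^+ m)%:E <=
    (G / (vF * normc k0) * (N * LL))%:E)%E.
  case: hT => hL2 hker _ _; rewrite GE.
  apply: (oscillation_le_commutator (l1 := l1) (l2 := l2) (M := n%:R) hL2 hker
    m_gt0 p1 mB mF Fv vF0 mb _ _ k00 eps_le _ l1A l2A L0 L'0 _ _ N0 Nb).
  - by move=> y [].
  - move=> y By; exists r => // z Fz.
    by have [] := near y z By (FB2 z Fz).
  - by move=> y z By Fz; have [] := near y z By (FB2 z Fz).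
  - by apply: subset_integral_le iL => //; exact: subset_trans FB2 B2B'.
  - apply: subset_integral_le iL' => //; first exact: measurable_fun_powR.
    by move=> y; exact: powR_ge0.
have bnd0 : 0 <= G / (vF * normc k0) * (N * LL).
  apply: mulr_ge0; last exact: mulr_ge0.
  by rewrite ltW// divr_gt0// mulr_gt0.
have mbc : cmeasurable (fun y => b y - cF).
  by apply: cmeasurableB => //; exact: cmeasurable_cst.
have [_ osc_1] := jensen_exprn mB (mu_qball hX x r0) (measurable_normc mbc)
  (fun y => normc_ge0 _) m_gt0 bnd0 osc_m.
set O1 := fine _ in osc_1.
have O10 : 0 <= O1.
  by apply: fine_ge0; apply: integral_ge0 => y _; rewrite lee_fin normc_ge0.
exists (2 * O1), W; split => //.
- by rewrite mulr_ge0.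
- exact: mean_oscillation_le mB (mu_qball hX x r0) v0 mb (bloc.2 x r r0).
rewrite exprMn -!mulrA ler_wpM2l ?exprn_ge0// !mulrA.
apply: le_trans osc_1 _.
(* Multiplying by the square of the volume gives the powers needed for [vW]. *)
rewrite -(ler_pM2r (exprn_gt0 2 v0)).
have mE : vol x r ^+ m.-1 * vol x r ^+ 2 = vol x r ^+ m.+1.
  by rewrite -exprD addn2 prednK.
rewrite -[leLHS]mulrA mE.
have vFV : vF^-1 * vol x (tau * r) <= 2 * D2.
  have y0x : rho y0 x <= S * r by rewrite (rhoC hX).
  have vF2 : vol y0 r <= 2 * vF by rewrite mulrC -ler_pdivrMr.
  rewrite mulrC ler_pdivrMr//; apply: le_trans (hD2 y0 x r r0 y0x) _.
  by rewrite (mulrC 2) -mulrA ler_wpM2l// ltW.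
have LLvW : LL * vol x r ^+ m.+1 <= W ^+ m * (A * vol x (tau * r) ^+ 2).
  rewrite (le_trans (ler_wpM2l LL0 vW))// mulrCA ler_wpM2l ?exprn_ge0//.
have v'v := hD1 x r r0.
have e1 : G / (vF * normc k0) * (N * LL) * vol x r ^+ m.+1 =
    G * N * (vF^-1 * ((normc k0)^-1 * (LL * vol x r ^+ m.+1))).
  by rewrite invfM; ring.
rewrite e1 [leRHS](_ : _ =
    G * N * (W ^+ m * A * (2 * D2) * (c * vol x r) * (D1 * vol x r))); last by ring.
rewrite ler_wpM2l ?mulr_ge0 ?(ltW G0)//.
have k0V0 : 0 <= (normc k0)^-1 by rewrite invr_ge0 ltW.
apply: (@le_trans _ _ (vF^-1 * ((normc k0)^-1 *
    (W ^+ m * (A * vol x (tau * r) ^+ 2))))).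
  by rewrite ler_wpM2l ?invr_ge0 ?(ltW vF0)// ler_wpM2l.
have -> : vF^-1 * ((normc k0)^-1 * (W ^+ m * (A * vol x (tau * r) ^+ 2))) =
  W ^+ m * A * (vF^-1 * vol x (tau * r)) * (normc k0)^-1 * vol x (tau * r).
  by ring.
have WA0 : 0 <= W ^+ m * A by rewrite mulr_ge0 ?exprn_ge0// ltW.
rewrite ler_pM// ?(ltW v'0)//.
  by rewrite !mulr_ge0 ?invr_ge0 ?exprn_ge0// ltW.
rewrite ler_pM//; last by rewrite ler_wpM2l.
by rewrite !mulr_ge0 ?invr_ge0 ?exprn_ge0// ltW.
Qed.

Lemma bmo_norm_le : exists2 C : R, 0 < C &
  forall (b : X -> R[i]) N, L1loc rho mu b -> 0 <= N ->
  (forall f, commutator_dom mu m b f -> in_Lpw mu p l1 f ->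
    (wnorm mu p l2 (iter_commutator m b T f) <= N%:E * wnorm mu p l1 f)%E) ->
  (bmo_norm rho mu (bloom_root p l1 l2 m) b <= ((C * N) `^ m%:R^-1)%:E)%E.
Proof.
have [C C0 hC] := oscillation_le; exists C => // b N bloc N0 Nb.
have m0 : 0 < m%:R :> R by rewrite ltr0n.
apply: ge_ereal_sup => _ [x [r [r0 ->]]].
have [osc [W [osc0 W0 hosc iW oscW]]] := hC b N bloc N0 Nb x r r0.
rewrite iW inver gt_eqF// lee_pdivrMr//; apply: le_trans hosc _.
rewrite -EFinM lee_fin -ler_pdivrMr//.
have oscW0 : 0 <= osc / W by rewrite divr_ge0// ltW.
have ratio : (osc / W) ^+ m <= C * N.
  by rewrite expr_div_n ler_pdivrMr ?exprn_gt0.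
rewrite [leLHS](_ : _ = ((osc / W) ^+ m) `^ m%:R^-1); last first.
  by rewrite -powR_mulrn// -powRrM mulfV ?gt_eqF// powRr1.
apply: (ge0_ler_powR _ _ _ ratio); first by rewrite invr_ge0 ltW.
  by rewrite nnegrE exprn_ge0.
by rewrite nnegrE mulr_ge0// ltW.
Qed.

End bloom_bmo.

Theorem theorem1p4 (R : realType) (d : measure_display) (X : measurableType d)
    (rho : X -> X -> R) (A0 : R) (mu : {measure set X -> \bar R})
    (hX : homogeneous_type rho A0 mu)
    (hinfty : mu [set: X] = +oo%E)
    (hatom : forall x0 : X, mu [set x0] = 0%E)
    (p : R) (hp : 1 < p)
    (lambda1 lambda2 : X -> R)
    (hlambda1 : Ap rho mu p lambda1) (hlambda2 : Ap rho mu p lambda2)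
    (m : nat) (hm : (1 <= m)%N)
    (T : (X -> complex R) -> (X -> complex R)) (K : X -> X -> complex R)
    (omega : R -> R)
    (hT : calderon_zygmund rho A0 mu T K omega)
    (homega : omega t @[t --> 0^'+] --> 0)
    (hK : nondegenerate_kernel rho mu K) :
  let nu : X -> R := fun x => lambda1 x `^ p^-1 * lambda2 x `^ (- p^-1) in
  let nu_m : X -> R := fun x => nu x `^ (m%:R)^-1 in
  exists2 C2 : R, 0 < C2 &
    forall b : X -> complex R, L1loc rho mu b ->
      (commutator_norm mu m b T p lambda1 lambda2 < +oo)%E ->
      in_BMO rho mu nu_m b /\
      (bmo_norm rho mu nu_m b ^+ m
       <= C2%:E * commutator_norm mu m b T p lambda1 lambda2)%E.
Proof.
move=> nu nu_m.
have [C C0 hC] := bmo_norm_le hX hp hlambda1 hlambda2 hT homega hK hm.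
have m0 : 0 < m%:R :> R by rewrite ltr0n.
exists C => // b bloc cfin.
have [x0 _] : exists x0 : X, True.
  apply: contrapT => /forallNP X0; move: hinfty.
  have -> : [set: X] = set0 by apply/seteqP; split => // x _; exact: X0 x I.
  by rewrite measure0.
have bmo_ge0 : (0 <= bmo_norm rho mu nu_m b)%E.
  apply: le_trans (ereal_sup_ubound _); last by exists x0, 1.
  rewrite mule_ge0 ?inve_ge0 ?integral_ge0// => y _; rewrite lee_fin.
    exact: normc_ge0.
  exact: powR_ge0.
have [_ [N1 [N10 hN1] <-] _] := ereal_inf_lt cfin.
have [t t0 bmoE] : exists2 t, 0 <= t & bmo_norm rho mu nu_m b = t%:E.
  exists (fine (bmo_norm rho mu nu_m b)); first exact: fine_ge0.
  rewrite fineK// ge0_fin_numE//.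
  exact: le_lt_trans (hC b N1 bloc N10 hN1) (ltry _).
have tm N : 0 <= N -> (forall f, commutator_dom mu m b f -> in_Lpw mu p lambda1 f ->
    (wnorm mu p lambda2 (iter_commutator m b T f)
     <= N%:E * wnorm mu p lambda1 f)%E) -> t ^+ m <= C * N.
  move=> N0 hN; have := hC b N bloc N0 hN.
  rewrite -/nu_m bmoE lee_fin => /(lerXn2r m).
  rewrite !nnegrE t0 powR_ge0 => /(_ isT isT) /le_trans; apply.
  rewrite -powR_mulrn ?powR_ge0// -powRrM mulVf ?gt_eqF// powRr1//.
  by rewrite mulr_ge0// ltW.
split.
  split => //; last by rewrite bmoE ltry.
  by right; exists 2; [rewrite ltr1n|exact: (Ap_bloom_root hX hp hlambda1 hlambda2 hm)].
rewrite bmoE -EFin_expe -lee_pdivrMl//.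
apply: le_ereal_inf_tmp => _ [N [N0 hN] <-].
by rewrite -EFinM lee_fin ler_pdivrMl// tm.
Qed.
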